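(* Let $G$ be a countable directed graph and let $(W^*(G),E)$ be the graph $W^*$-probability space over its diagonal subalgebra $D_G$. Then $(W^*(G),E)$ has the following free product structure: $$\left(W^*(G),E\right)=\left(D_G,E\right)*_{D_G}\left(\underset{e\in E(G)}{*_{D_G}}\left(W^*(\{L_e\},D_G),E\right)\right).$$
   Context: Let $G$ be a countable directed graph with vertex set $V(G)$, edge set $E(G)$, and $FP(G)$ the set of all admissible finite paths (of length $\ge 1$; edges are paths of length $1$). The free semigroupoid is $\mathbb{F}^+(G)=V(G)\cup FP(G)$ with the partial product given by admissible concatenation, vertices acting as units; write $w=v_1wv_2$ if $w$ has initial vertex $v_1$ and final vertex $v_2$. Let $H_G=\ell^2(\mathbb{F}^+(G))$ with Hilbert basis $\{\xi_w:w\in\mathbb{F}^+(G)\}$. For $w\in\mathbb{F}^+(G)$, $L_w$ is the multiplication (creation) operator with symbol $\xi_w$: $L_w\xi_{w'}=\xi_{ww'}$ if $ww'$ is admissible and $0$ otherwise; $L_w^*$ is its adjoint. For $w=v_1wv_2$ the paper works with the relations $L_w=L_{v_1}L_wL_{v_2}$, $L_wL_w^*=L_{v_1}$, $L_w^*L_w=L_{v_2}$, $L_wL_w^*L_w=L_w$, and $L_v$ is a projection for $v\in V(G)$. The graph $W^*$-algebra is $W^*(G)=\overline{\mathbb{C}[\{L_w,L_w^*:w\in\mathbb{F}^+(G)\}]}^{w}$ (weak closure) and its diagonal subalgebra is $D_G=\overline{\mathbb{C}[\{L_v:v\in V(G)\}]}^{w}$. Each $a\in W^*(G)$ is expressed by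 its Fourier expansion $a=\sum_{v\in V(G)}p_vL_v+\sum_{w\in FP(G)}(p_wL_w+p_w^*L_w^* )$ with complex coefficients $p_v,p_w,p_w^*$ ($p_w^*$ is not assumed to be the conjugate of $p_w$), and $E:W^*(G)\to D_G$ is the conditional expectation $E(a)=\sum_{v\in V(G)}p_vL_v$. The pair $(W^*(G),E)$ is the graph $W^*$-probability space over $D_G$; $E$ also denotes its restrictions to subalgebras. For $S\subset W^*(G)$, $W^*(S,D_G)$ is the $W^*$-subalgebra of $W^*(G)$ generated by $S$ and $D_G$. The symbol $*_{D_G}$ denotes the $W^*$-free product with amalgamation over $D_G$ (freeness over $D_G$ in the sense of Speicher).
   Formalization: The relation L_wL_w^*=L_{v_1} fails for creation operators (e.g. two loops at a vertex), and L_wL_w^* need not have a Fourier expansion; so the relation is dropped and E is defined on all of W^*(G) by p_v=<aξ_v,ξ_v>, which agrees with the paper's formula on finite Fourier sums. *)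

(* Defs.v *)
From HB Require Import structures.
From mathcomp Require Import all_boot all_order all_algebra finmap.
From mathcomp Require Import complex ring.
From mathcomp Require Import mathcomp_extra boolp classical_sets functions.
From mathcomp Require Import cardinality fsbigop reals ereal esum.

Set Implicit Arguments.
Unset Strict Implicit.
Unset Printing Implicit Defensive.
Import Order.TTheory GRing.Theory Num.Theory.
Import Normc.
Local Open Scope classical_set_scope.
Local Open Scope ring_scope.

Section EllTwo.
Variables (R : realType) (I : choiceType).
Implicit Types (f : I -> R) (g h : I -> R[i]).

(* Unconditional sums.  The value is meaningful only for absolutely summable
   families, which is the case in the inner product below. *)
Definition rsum f : R :=
  fine (\esum_(i in [set: I]) (Num.max (f i) 0)%:E) -
  fine (\esum_(i in [set: I]) (Num.max (- f i) 0)%:E).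

Definition csum g : R[i] :=
  Complex (rsum (fun i => complex.Re (g i))) (rsum (fun i => complex.Im (g i))).

Definition ell2 : {pred I -> R[i]} :=
  [pred g | `[< (\esum_(i in [set: I]) (normc (g i) ^+ 2)%:E < +oo)%E >]].

Lemma ell2P g :
  reflect (\esum_(i in [set: I]) (normc (g i) ^+ 2)%:E < +oo)%E (g \in ell2).
Proof. by rewrite inE; exact: asboolP. Qed.

Lemma normc_ge0 (z : R[i]) : 0 <= normc z.
Proof. by case: z => x y; exact: sqrtr_ge0. Qed.

Lemma esum_scale_fin (k : R) f : 0 <= k -> (forall i, 0 <= f i) ->
  (\esum_(i in [set: I]) (f i)%:E < +oo ->
   \esum_(i in [set: I]) (k%:E * (f i)%:E) < +oo)%E.
Proof.
move=> k0 f0 fs.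
apply: (@le_lt_trans _ _ (k%:E * \esum_(i in [set: I]) (f i)%:E)%E).
  apply: ge_ereal_sup => _ [X [finX _] <-].
  rewrite -ge0_mule_fsumr//; apply: lee_wpmul2l; rewrite ?lee_fin//.
  by apply: esum_ge; exists X.
by rewrite lte_mul_pinfty// ge0_fin_numE// esum_ge0// => i _; rewrite lee_fin.
Qed.

Lemma ell2_submod_closed : submod_closed ell2.
Proof.
split.
  apply/ell2P; rewrite esum1 ?ltry// => i _.
  by rewrite [X in normc X](_ : _ = 0)// normc0 expr0n.
move=> a g h /ell2P hg /ell2P hh; apply/ell2P.
apply: (@le_lt_trans _ _ (\esum_(i in [set: I])
   ((2 * normc a ^+ 2)%:E * (normc (g i) ^+ 2)%:E +
    2%:E * (normc (h i) ^+ 2)%:E))%E).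
  apply: le_esum => i _; rewrite -!EFinM -EFinD lee_fin.
  have -> : (a *: g + h) i = a * g i + h i by [].
  have := le_normcD (a * g i) (h i); rewrite normcM.
  have -> : 2 * normc a ^+ 2 * normc (g i) ^+ 2 =
            2 * (normc a * normc (g i)) ^+ 2 by ring.
  set u := normc a * normc (g i); set v := normc (h i); move=> le1.
  apply: (@le_trans _ _ ((u + v) ^+ 2)).
    by rewrite lerXn2r// nnegrE ?normc_ge0// addr_ge0// ?mulr_ge0 ?normc_ge0.
  rewrite -subr_ge0 (_ : _ - _ = (u - v) ^+ 2); last by ring.
  exact: sqr_ge0.
have n2 (z : R[i]) : 0 <= normc z ^+ 2 by exact: sqr_ge0.
have a2 : 0 <= 2 * normc a ^+ 2 by exact: mulr_ge0.
have z2 : (0 <= 2%:E :> \bar R)%E by rewrite lee_fin.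
rewrite esumD.
- by rewrite lte_add_pinfty//; exact: esum_scale_fin.
- by move=> i _; apply: mule_ge0; rewrite lee_fin.
- by move=> i _; apply: mule_ge0; rewrite // lee_fin.
Qed.

Lemma rsum_single (u : I) (c : R) f :
  (forall i, f i = if i == u then c else 0) -> rsum f = c.
Proof.
move=> fE.
have S1 (k : R) (h : I -> R) : 0 <= k -> (forall i, h i = if i == u then k else 0) ->
    \esum_(i in [set: I]) (h i)%:E = k%:E.
  move=> k0 hE; have -> : \esum_(i in [set: I]) (h i)%:E =
      \esum_(i in [set: I]) if i \in [set u] then k%:E else 0%:E.
    apply: eq_esum => i _; rewrite hE.
    case: (ifPn (i \in _)) => [/set_mem->|]; first by rewrite eqxx.
    by rewrite notin_setE => /eqP/negPf->.
  by rewrite -esum_mkcond esum_set1 ?lee_fin.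
rewrite /rsum (S1 (Num.max c 0)) ?(S1 (Num.max (- c) 0)) //=.
- have [c0|/ltW c0] := leP 0 c.
    by rewrite [Num.max (- c) 0]max_r ?subr0// oppr_le0.
  by rewrite max_l ?sub0r ?opprK// oppr_ge0.
- by rewrite le_max lexx orbT.
- by move=> i; rewrite fE; case: eqP => // _; rewrite oppr0 maxxx.
- by rewrite le_max lexx orbT.
- by move=> i; rewrite fE; case: eqP => // _; rewrite maxxx.
Qed.

Lemma csum_single (u : I) (c : R[i]) g :
  (forall i, g i = if i == u then c else 0) -> csum g = c.
Proof.
move=> gE; rewrite /csum (@rsum_single u (complex.Re c)) => [|i].
  rewrite (@rsum_single u (complex.Im c)) => [|i]; first by case: (c).
  by rewrite gE; case: eqP.
by rewrite gE; case: eqP.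
Qed.

HB.instance Definition _ :=
  GRing.isSubmodClosed.Build R[i] (I -> R[i]) ell2 ell2_submod_closed.

Record hilbert := Hilbert { hval :> I -> R[i]; hvalP : hval \in ell2 }.
HB.instance Definition _ := [isSub for hval].
HB.instance Definition _ := [Choice of hilbert by <:].
HB.instance Definition _ := [SubChoice_isSubLmodule of hilbert by <:].

Implicit Types x y : hilbert.

Definition inner x y : R[i] := csum (fun i => x i * (y i)^*%C).

Definition hnorm x : R :=
  Num.sqrt (fine (\esum_(i in [set: I]) (normc (x i) ^+ 2)%:E)).

Lemma basis_subproof u : (fun i => (i == u)%:R : R[i]) \in ell2.
Proof.
apply/ell2P; rewrite (_ : esum _ _ =
    \esum_(i in [set: I]) if i \in [set u] then 1%:E else 0%:E); last first.
  apply: eq_esum => i _; case: ifPn => [/set_mem->|].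
    by rewrite eqxx normc1 expr1n.
  by rewrite notin_setE => /eqP/negPf->; rewrite normc0 expr0n.
by rewrite -esum_mkcond esum_set1 ?lee_fin// ltry.
Qed.

Definition basis u : hilbert := Hilbert (basis_subproof u).

Lemma inner_basis x u : inner x (basis u) = x u.
Proof.
apply: (@csum_single u) => i /=; case: eqP => [->|_].
  by rewrite conjc1 mulr1.
by rewrite conjc0 mulr0.
Qed.

Lemma inner_basisl x u : inner (basis u) x = (x u)^*%C.
Proof.
by apply: (@csum_single u) => i /=; case: eqP => [->|_]; rewrite ?mul1r ?mul0r.
Qed.

End EllTwo.

Arguments basis {R I} u.

Section Operators.
Variables (R : realType) (I : choiceType).
Local Notation H := (hilbert R I).
Local Notation op := (H -> H).
Implicit Types (T S : op) (A : set op).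

Definition bounded_op T :=
  linear T /\ exists c : R, forall x, hnorm (T x) <= c * hnorm x.

Definition adjoint T S := forall x y, inner (T x) y = inner x (S y).

(* The algebra of noncommutative polynomials in the elements of A. *)
Inductive alg A : set op :=
| alg_gen T : A T -> alg A T
| alg_one : alg A id
| alg_add T S : alg A T -> alg A S -> alg A (fun x => T x + S x)
| alg_scale c T : alg A T -> alg A (fun x => c *: T x)
| alg_mul T S : alg A T -> alg A S -> alg A (T \o S).

(* Closure in B(H) for the weak operator topology. *)
Definition wclosure A : set op := [set T | bounded_op T /\
  forall (s : seq (H * H)) (eps : R), 0 < eps ->
    exists2 S, A S & forall p, p \in s ->
      normc (inner (T p.1 - S p.1) p.2) < eps].

Definition adjoints A : set op := [set T | exists2 S, A S & adjoint S T].

(* The W*-algebra generated by A: a unital *-algebra of bounded operators is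
   weakly closed iff it is a von Neumann algebra. *)
Definition wstar A : set op := wclosure (alg (A `|` adjoints A)).

Definition positive_op T := forall x, 0 <= inner (T x) x.

(* Weak operator continuity on norm-bounded subsets of M; for linear maps
   between von Neumann algebras this is normality. *)
Definition normal_map (M : set op) (E : op -> op) :=
  forall (c : R) (x y : H) (eps : R), 0 < eps ->
  exists (s : seq (H * H)) (delta : R), 0 < delta /\
    forall T, M T -> (forall z, hnorm (T z) <= c * hnorm z) ->
      (forall p, p \in s -> normc (inner (T p.1) p.2) < delta) ->
      normc (inner (E T x) y) < eps.

Record conditional_expectation (D M : set op) (E : op -> op) : Prop := {
  ce_range : forall T, M T -> D (E T);
  ce_id : forall T, D T -> E T = T;
  ce_linear : forall (c : R[i]) T S, M T -> M S ->
    E (fun x => c *: T x + S x) = (fun x => c *: E T x + E S x);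
  ce_bimodule : forall d T d', D d -> M T -> D d' ->
    E (d \o T \o d') = d \o E T \o d';
  ce_positive : forall T, M T -> positive_op T -> positive_op (E T);
  ce_normal : normal_map M E }.

Record wprob_space (D M : set op) (E : op -> op) : Prop := {
  wp_base : wstar D = D;
  wp_alg : wstar M = M;
  wp_sub : D `<=` M;
  wp_ce : conditional_expectation D M E }.

(* The product a 0 \o a 1 \o ... \o a n. *)
Definition op_prod n (a : nat -> op) : op :=
  \big[(fun S T : op => S \o T)/id]_(k < n.+1) a k.

Definition free_over (E : op -> op) (J : Type) (A : J -> set op) :=
  forall n (j : nat -> J) (a : nat -> op),
    (forall k, (k <= n)%N -> A (j k) (a k) /\ E (a k) = (fun=> 0)) ->
    (forall k, (k < n)%N -> j k <> j k.+1) ->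
    E (op_prod n a) = (fun=> 0).

(* (M, E) is the W*-free product with amalgamation over D of the (A j, E).
   The last condition says that the GNS representation of (M, E) is faithful;
   together with the others it determines (M, E) up to isomorphism from the
   family (A j, E).  The free product of the empty family is (D, E). *)
Record is_wfree_product (D : set op) (E : op -> op) (J : Type)
    (A : J -> set op) (M : set op) : Prop := {
  fp_factor : forall j, wprob_space D (A j) E;
  fp_space : wprob_space D M E;
  fp_generated : M = wstar (D `|` \bigcup_j A j);
  fp_free : free_over E A;
  fp_nondegenerate : forall T, M T ->
    (forall S U, M S -> M U -> E (S \o T \o U) = (fun=> 0)) -> T = (fun=> 0) }.

End Operators.

(* Loops and parallel edges are allowed. *)
Record digraph := Digraph {
  vert : countType; edge : countType;
  src : edge -> vert; tgt : edge -> vert }.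

Section Semigroupoid.
Variable G : digraph.

Fixpoint admissible (v : vert G) (p : seq (edge G)) : bool :=
  if p is e :: q then (src e == v) && admissible (tgt e) q else true.

Definition is_path (w : vert G * seq (edge G)) : bool := admissible w.1 w.2.

(* The free semigroupoid V(G) \cup FP(G): an element is an initial vertex
   together with an admissible sequence of edges from it.  The vertex v is
   (v, [::]); the elements of FP(G) are those with a nonempty sequence. *)
Record fsgd := Fsgd { fsgd_val : vert G * seq (edge G); _ : is_path fsgd_val }.
HB.instance Definition _ := [isSub for fsgd_val].
HB.instance Definition _ := [Countable of fsgd by <:].

Definition ini (w : fsgd) : vert G := (val w).1.
Definition edges (w : fsgd) : seq (edge G) := (val w).2.
Definition fin (w : fsgd) : vert G := last (ini w) (map (@tgt G) (edges w)).

Definition vertex (v : vert G) : fsgd := @Fsgd (v, [::]) isT.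

Lemma edge_path_subproof (e : edge G) : is_path (src e, [:: e]).
Proof. by rewrite /is_path /= eqxx. Qed.
Definition edge_path (e : edge G) : fsgd := Fsgd (edge_path_subproof e).

(* Concatenation, None when it is not admissible. *)
Definition concat (w w' : fsgd) : option fsgd :=
  if fin w == ini w' then insub (ini w, edges w ++ edges w') else None.

(* Left division: the w' such that concat w w' = Some u, if any. *)
Definition ldiv (w u : fsgd) : option fsgd :=
  if (ini u == ini w) && prefix (edges w) (edges u)
  then insub (fin w, drop (size (edges w)) (edges u)) else None.

Lemma admissible_cat v p q : admissible v (p ++ q) =
  admissible v p && admissible (last v (map (@tgt G) p)) q.
Proof. by elim: p v => //= e p IH v; rewrite IH andbA. Qed.

Lemma ldivP w u w' : (ldiv w u = Some w') <-> (concat w w' = Some u).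
Proof.
rewrite /ldiv /concat; split.
  case: ifP => // /andP[/eqP iu /prefixP[q eu]].
  case: insubP => // w1 _ ew1 [<-]; have iw1 : ini w1 = fin w by rewrite /ini ew1.
  have ed1 : edges w1 = q by rewrite /edges ew1 /= eu drop_size_cat.
  rewrite iw1 eqxx ed1 -eu -iu [(_, _)](_ : _ = val u) ?valK//.
  by rewrite /ini /edges; case: (val u).
case: ifP => // /eqP fw; case: insubP => // u1 _ eu1 [<-].
rewrite {1}/ini eu1/= eqxx/= /edges eu1/= prefix_prefix/= drop_size_cat//.
rewrite fw [(_, _)](_ : _ = val w') ?valK//.
by rewrite /ini /edges; case: (val w').
Qed.

End Semigroupoid.

Section GraphAlgebra.
Variables (R : realType) (G : digraph).
Local Notation F := (fsgd G).
Local Notation H := (hilbert R F).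
Implicit Types (w u : F) (x y : H) (v : vert G).

Lemma creation_subproof w x :
  (fun u => oapp (hval x) 0 (ldiv w u) : R[i]) \in @ell2 R F.
Proof.
apply/ell2P; pose a (o : option F) : \bar R := (normc (oapp (hval x) 0 o) ^+ 2)%:E.
pose P := [set u : F | ldiv w u].
have a0 o : (0 <= a o)%E by rewrite lee_fin sqr_ge0.
have -> : \esum_(u in [set: F]) a (ldiv w u) = \esum_(u in P) a (ldiv w u).
  rewrite [RHS]esum_mkcond; apply: eq_esum => u _.
  case: ifPn => //; rewrite notin_setE /P/= => /negP; rewrite /a.
  by case: (ldiv w u) => //= _; rewrite expr0n/= addr0 sqrtr0 expr0n.
rewrite -(esum_image P (ldiv w) a); last first.
  move=> u u' /set_mem hu _ Euu'; move: hu; rewrite /P/=.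
  case E : (ldiv w u) => [w'|//] _.
  have /ldivP E1 := E; move: E; rewrite Euu' => /ldivP.
  by rewrite E1 => -[].
apply: (@le_lt_trans _ _ (\esum_(o in Some @` [set: F]) a o)).
  rewrite esum_mkcond [leRHS]esum_mkcond; apply: le_esum => o _.
  case: ifPn => [|_]; last by case: ifP.
  rewrite inE => -[u Pu <-]; rewrite mem_set//.
  by move: Pu; rewrite /P/=; case: (ldiv w u) => // w' _; exists w'.
rewrite esum_image => [|u u' _ _ []//].
exact/ell2P/(hvalP x).
Qed.

(* L_w, given by its coordinates: (L_w x)(w w') = x(w'), and (L_w x)(u) = 0
   when u does not factor through w. *)
Definition creation w x : H := Hilbert (creation_subproof w x).

Lemma creation_basis w w' :
  creation w (basis w') = oapp basis 0 (concat w w').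
Proof.
apply/val_inj/funext => u /=.
case E : (concat w w') => [u'|] /=.
  case E' : (ldiv w u) => [w1|] /=.
    suff -> : (w1 == w') = (u == u') by [].
    apply/eqP/eqP => e.
      by move: E'; rewrite e => /ldivP; rewrite E => -[->].
    by move: E'; rewrite e => E'; move/ldivP: E; rewrite E' => -[->].
  case: eqP => // e; move/ldivP: E; rewrite -e E'; discriminate.
case E' : (ldiv w u) => [w1|] //=.
by case: eqP => // e; move/ldivP: E'; rewrite e E; discriminate.
Qed.

Definition graph_walg : set (H -> H) := wstar [set creation w | w in [set: F]].

Definition diag_alg : set (H -> H) :=
  wclosure (alg [set creation (vertex v) | v in [set: vert G]]).

(* W*(S, D_G) *)
Definition walg_over_diag (S : set (H -> H)) : set (H -> H) :=
  wstar (S `|` diag_alg).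

(* The Fourier coefficient p_v of T: the coefficient of the basis vector of v
   in the image of that vector, see cond_exp_fourier.  It is defined on all of
   graph_walg, which is not the closed span of the L_w and L_w^* : it contains
   L_w L_w^*, the projection onto the paths that extend w. *)
Definition vcoef (T : H -> H) v : R[i] :=
  inner (T (basis (vertex v))) (basis (vertex v)).

(* E(T) = \sum_v p_v L_v, which acts diagonally.  For a bounded T the
   coefficients are bounded and the default value 0 of insubd is not used. *)
Definition cond_exp (T : H -> H) : H -> H :=
  fun x => insubd 0 (fun u => vcoef T (ini u) * x u).

Lemma hvalD x y u : (x + y) u = x u + y u. Proof. by []. Qed.
Lemma hvalZ (c : R[i]) x u : (c *: x) u = c * x u. Proof. by []. Qed.
Lemma hval_sum (J : Type) (s : seq J) (h : J -> H) u :
  (\sum_(j <- s) h j) u = \sum_(j <- s) h j u.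
Proof. by elim/big_rec2: _ => // j y1 y2 _ <-. Qed.

Lemma creation_vertexE v x u : creation (vertex v) x u = (ini u == v)%:R * x u.
Proof.
rewrite /= /ldiv /= prefix0s andbT; case: eqP => [e|_]; last by rewrite mul0r.
rewrite /fin /= drop0 -e [(_, _)](_ : _ = val u) ?valK ?mul1r//.
by rewrite /ini /edges; case: (val u).
Qed.

(* On finite Fourier expansions, cond_exp keeps exactly the vertex terms. *)
Lemma cond_exp_fourier (sv : seq (vert G)) (sw : seq F)
    (p : vert G -> R[i]) (q q' : F -> R[i]) (Ls : F -> H -> H) :
  (forall w, w \in sw -> edges w != [::]) ->
  (forall w, adjoint (creation w) (Ls w)) ->
  cond_exp (fun x => \sum_(v <- sv) p v *: creation (vertex v) x +
      \sum_(w <- sw) (q w *: creation w x + q' w *: Ls w x)) =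
  (fun x => \sum_(v <- sv) p v *: creation (vertex v) x).
Proof.
move=> swP LsP; apply/funext => x; rewrite /cond_exp.
set y := RHS; rewrite [X in insubd 0 X](_ : _ = val y) ?valKd//.
apply/funext => u; rewrite /y /vcoef inner_basis hvalD !hval_sum.
rewrite [X in _ + X]big1_seq ?addr0 => [|w /andP[_ /swP wP]]; last first.
  have cw : creation w (basis (vertex (ini u))) (vertex (ini u)) = 0.
    rewrite /= /ldiv /=; case: (edges w) wP => //= e l _.
    by rewrite andbF.
  rewrite hvalD !hvalZ cw mulr0 add0r.
  rewrite -[Ls w _ _]conjcK -inner_basisl -LsP inner_basis cw conjc0.
  by rewrite mulr0.
rewrite -[RHS]/((\sum_(v <- sv) p v *: creation (vertex v) x) u) hval_sum.
rewrite mulr_suml; apply: eq_bigr => v _; rewrite !hvalZ !creation_vertexE /=.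
by rewrite eqxx mulr1 mulrA.
Qed.

End GraphAlgebra.

Arguments graph_walg : clear implicits.
Arguments diag_alg : clear implicits.
Arguments cond_exp : clear implicits.

(* Main.v *)
From mathcomp Require Import all_boot all_order all_algebra finmap.
From mathcomp Require Import complex ring lra.
From mathcomp Require Import boolp classical_sets functions.
From mathcomp Require Import cardinality fsbigop reals ereal esum.
Require Import Defs.

(** The intermediate algebra B is W*(G) itself: every L_w with w a nonempty
    path is a product of operators L_e, so the edge algebras
    A_e = W*({L_e}, D_G) already generate W*(G) (graph_walg_generated), and the
    further free factor D_G is absorbed because an element d of D_G with
    E(d) = 0 vanishes (diag_free).

    The heart of the matter is the freeness of the A_e over D_G.  Fix an edge e
    and a path u that does not start with e.  The partial isometry that sends
    the basis vector of e...eu to that of e...e and kills all the other basis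
    vectors commutes with L_e, with its adjoint and with D_G, hence with all of
    A_e (edge_algebra_commute).  Reading off one coordinate of this commutation
    gives (T x)(u) = p_v x(u) for T in A_e, where v is the initial vertex of u,
    p_v the coefficient of L_v in E(T), and x any vector that vanishes on the
    paths starting with e (edge_algebra_off).  So if E(T) = 0, then T maps the
    vectors that vanish on the paths starting with e to vectors that live on
    these paths.  Apply an alternating product of centred elements of A_(e_0),
    ..., A_(e_n) to the basis vector of a vertex: by induction the result lives
    on paths that start with e_0 (op_prod_off), and so it is orthogonal to all
    vertices, which is to say that E of the product is zero.

    The same commutation principle (commute_wclosure) handles the other weak
    closures.  Elements of D_G are diagonal with entries depending on the initial
    vertex only (diagE); and elements of W*(G) preserve the final vertex of a
    path (graph_fin), since left creation operators commute with the projections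
    determined by the final vertex.  The latter yields faithfulness of the GNS
    representation: E(L_w^* T L_u) recovers the matrix entry of T at (u, w)
    whenever u and w end at the same vertex, and the other entries vanish
    (graph_nondegenerate).

    What remains is operator theory on l^2.  Weak closures of selfadjoint
    algebras are again algebras, by approximating one factor of a product at a
    time (wclosure_mul).  That E is a normal positive
    D_G-bimodule projection onto D_G holds on all bounded operators, and is
    proved by cutting vectors off to finitely many coordinates
    (mulop_outside_small, diag_mulop, cond_exp_normal). *)

Set Implicit Arguments.
Unset Strict Implicit.
Unset Printing Implicit Defensive.
Import Order.TTheory GRing.Theory Num.Theory.
Import Normc.
Local Open Scope classical_set_scope.
Local Open Scope ring_scope.

(** * Sums of nonnegative families *)
Section PositiveSums.
Variables (R : realType) (I : choiceType).
Implicit Types (f g : I -> R).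

Definition esumT f : \bar R := \esum_(i in [set: I]) (f i)%:E.
Definition tsum f : R := fine (esumT f).
Definition sfin f : Prop := (esumT f < +oo)%E.

Lemma esumT_tsum f : (forall i, 0 <= f i) -> sfin f -> esumT f = (tsum f)%:E.
Proof.
move=> f0 ff; rewrite /tsum fineK// ge0_fin_numE//.
by apply: esum_ge0 => i _; rewrite lee_fin.
Qed.

Lemma tsum_ge0 f : (forall i, 0 <= f i) -> 0 <= tsum f.
Proof. by move=> f0; apply/fine_ge0/esum_ge0 => i _; rewrite lee_fin. Qed.

Lemma sfin_le f g : (forall i, f i <= g i) -> sfin g -> sfin f.
Proof. by move=> fg; apply: le_lt_trans; apply: le_esum => i _; rewrite lee_fin. Qed.

Lemma tsum_le f g : (forall i, 0 <= f i <= g i) -> sfin g -> tsum f <= tsum g.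
Proof.
move=> fg gf; have f0 i : 0 <= f i by case/andP: (fg i).
have fleg i : f i <= g i by case/andP: (fg i).
have g0 i : 0 <= g i := le_trans (f0 i) (fleg i).
rewrite -lee_fin -!esumT_tsum//; last exact: sfin_le gf.
by apply: le_esum => i _; rewrite lee_fin.
Qed.

Lemma esumTD f g : (forall i, 0 <= f i) -> (forall i, 0 <= g i) ->
  esumT (fun i => f i + g i) = (esumT f + esumT g)%E.
Proof.
by move=> f0 g0; rewrite -esumD//= => i _; rewrite lee_fin.
Qed.

Lemma sfinD f g : (forall i, 0 <= f i) -> (forall i, 0 <= g i) ->
  sfin f -> sfin g -> sfin (fun i => f i + g i).
Proof. by move=> f0 g0 ff gf; rewrite /sfin esumTD// lte_add_pinfty. Qed.

Lemma tsumD f g : (forall i, 0 <= f i) -> (forall i, 0 <= g i) ->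
  sfin f -> sfin g -> tsum (fun i => f i + g i) = tsum f + tsum g.
Proof. by move=> f0 g0 ff gf; rewrite {1}/tsum esumTD// !esumT_tsum. Qed.

Lemma sfinZ (k : R) f : 0 <= k -> (forall i, 0 <= f i) -> sfin f ->
  sfin (fun i => k * f i).
Proof. by move=> k0 f0 /(esum_scale_fin k0 f0). Qed.

Lemma tsumZ_le (k : R) f : 0 <= k -> (forall i, 0 <= f i) -> sfin f ->
  tsum (fun i => k * f i) <= k * tsum f.
Proof.
move=> k0 f0 ff; rewrite -lee_fin -esumT_tsum; last 2 first.
- by move=> i; rewrite mulr_ge0.
- exact: sfinZ.
rewrite EFinM -esumT_tsum//; apply: ge_ereal_sup => _ [X [finX _] <-].
rewrite (eq_fsbigr (fun i => k%:E * (f i)%:E)%E)//.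
rewrite -ge0_mule_fsumr//; apply: lee_wpmul2l; rewrite ?lee_fin//.
by apply: esum_ge; exists X.
Qed.

Lemma tsumZ (k : R) f : 0 <= k -> (forall i, 0 <= f i) -> sfin f ->
  tsum (fun i => k * f i) = k * tsum f.
Proof.
move=> k0 f0 ff; apply/eqP; rewrite eq_le tsumZ_le//=.
have [->|kn0] := eqVneq k 0.
  by rewrite mul0r; apply: tsum_ge0 => i; rewrite mul0r.
have kp : 0 < k by rewrite lt_def kn0.
rewrite -ler_pdivlMl//.
have kf0 i : 0 <= k * f i by rewrite mulr_ge0.
have := @tsumZ_le k^-1 _ _ kf0 (sfinZ k0 f0 ff); rewrite invr_ge0 => /(_ k0).
by congr (_ <= _); congr tsum; apply/funext => i; rewrite mulKf.
Qed.

(** A finite sum close to the supremum leaves only a small tail; this is the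
    source of all the approximations by finitely many coordinates. *)
Lemma tsum_tail f (eps : R) : (forall i, 0 <= f i) -> sfin f -> 0 < eps ->
  exists X : seq I, tsum (fun i => if i \in X then 0 else f i) < eps.
Proof.
move=> f0 ff e0.
have ee : (0 < (eps/2)%:E)%E by rewrite lte_fin divr_gt0.
have fn : esumT f \is a fin_num by rewrite esumT_tsum.
have [_ [X [finX _] <-] ltX] := ub_ereal_sup_adherent ee fn.
exists (fset_set X).
set t := (X in tsum X).
have t0 i : 0 <= t i by rewrite /t; case: ifP.
have tf i : t i <= f i by rewrite /t; case: ifP.
pose s i := if i \in fset_set X then f i else 0.
have s0 i : 0 <= s i by rewrite /s; case: ifP.
have sf i : s i <= f i by rewrite /s; case: ifP.
have sE : esumT s = (\sum_(i \in X) (f i)%:E)%E.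
  rewrite -esum_fset// => [|i _]; last by rewrite lee_fin.
  rewrite [RHS]esum_mkcond; apply: eq_esum => i _.
  by rewrite /s in_fset_set//; case: ifP.
have : tsum f = tsum s + tsum t.
  rewrite -tsumD//; [|exact: sfin_le ff..].
  by congr tsum; apply/funext => i; rewrite /s /t; case: ifP; rewrite ?addr0 ?add0r.
move: ltX; rewrite -sE -[ereal_sup _]/(esumT f) !esumT_tsum//; last exact: sfin_le ff.
rewrite -EFinB lte_fin; lra.
Qed.

End PositiveSums.

(** * Unconditional complex sums *)
Section ComplexSums.
Variables (R : realType) (I : choiceType).
Implicit Types (f g : I -> R) (x y z : hilbert R I).

Lemma maxr0_ge0 (a : R) : 0 <= Num.max a 0. Proof. by rewrite le_max lexx orbT. Qed.

(** Any splitting into a difference of nonnegative summable families computes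
    the sum, not just the one into positive and negative parts; linearity
    follows. *)
Lemma rsumB f g : (forall i, 0 <= f i) -> (forall i, 0 <= g i) ->
  sfin f -> sfin g -> rsum (fun i => f i - g i) = tsum f - tsum g.
Proof.
move=> f0 g0 ff gf; pose h i := f i - g i.
pose hp i := Num.max (h i) 0; pose hm i := Num.max (- h i) 0.
have p0 i : 0 <= hp i by exact: maxr0_ge0.
have m0 i : 0 <= hm i by exact: maxr0_ge0.
have E : tsum (fun i => hp i + g i) = tsum (fun i => hm i + f i).
  congr tsum; apply/funext => i; rewrite /hp /hm /h; move: (f i) (g i) => a b.
  have [ab|ab] := leP (a - b) 0; last by rewrite max_r ?subrK ?add0r//; lra.
  by rewrite max_l; lra.
have pf : sfin hp.
  by apply: sfin_le ff => i; rewrite ge_max f0 /h gerBl g0.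
have mf : sfin hm.
  by apply: sfin_le gf => i; rewrite ge_max g0 /h opprB gerBl f0.
move: E; rewrite !tsumD// => E.
by rewrite [LHS](_ : _ = tsum hp - tsum hm)//; lra.
Qed.

Lemma rsumN f : rsum (fun i => - f i) = - rsum f.
Proof.
rewrite /rsum opprB; congr (_ - fine _); apply: eq_esum => i _.
by rewrite opprK.
Qed.

Lemma rsum_parts f : sfin (fun i => `|f i|) ->
  exists p m, [/\ forall i, 0 <= p i, forall i, 0 <= m i, sfin p, sfin m
    & forall i, f i = p i - m i].
Proof.
move=> ff; exists (fun i => Num.max (f i) 0), (fun i => Num.max (- f i) 0).
split=> [i|i|||i]; rewrite ?maxr0_ge0//.
- by apply: sfin_le ff => i; rewrite ge_max ler_norm/=.
- by apply: sfin_le ff => i; rewrite ge_max -normrN ler_norm/=.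
have [f0|/ltW f0] := leP 0 (f i).
  by rewrite max_r ?subr0// oppr_le0.
by rewrite max_l ?sub0r ?opprK// oppr_ge0.
Qed.

Lemma rsumD f g : sfin (fun i => `|f i|) -> sfin (fun i => `|g i|) ->
  rsum (fun i => f i + g i) = rsum f + rsum g.
Proof.
move=> /rsum_parts[p [m [p0 m0 pf mf /funext->]]].
move=> /rsum_parts[q [n [q0 n0 qf nf /funext->]]].
rewrite !rsumB//; transitivity (rsum (fun i => (p i + q i) - (m i + n i))).
  by congr rsum; apply/funext => i; lra.
rewrite rsumB ?tsumD//; try exact: sfinD; try by move=> i; rewrite addr_ge0.
lra.
Qed.

Lemma rsumZ (k : R) f : sfin (fun i => `|f i|) ->
  rsum (fun i => k * f i) = k * rsum f.
Proof.
move=> /rsum_parts[p [m [p0 m0 pf mf /funext->]]].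
wlog k0 : k / 0 <= k => [H|].
  have [|/ltW k0] := leP 0 k; first exact: H.
  rewrite -[k]opprK mulNr -H ?oppr_ge0// -rsumN.
  by congr rsum; apply/funext => i; lra.
rewrite rsumB//; transitivity (rsum (fun i => k * p i - k * m i)).
  by congr rsum; apply/funext => i; lra.
rewrite rsumB ?tsumZ//; try exact: sfinZ; try by move=> i; rewrite mulr_ge0.
lra.
Qed.

Lemma rsum_ge0E f : (forall i, 0 <= f i) -> rsum f = tsum f.
Proof.
move=> f0; rewrite /rsum [X in fine X - _](_ : _ = esumT f); last first.
  by apply: eq_esum => i _; rewrite max_l.
by rewrite esum1 ?subr0// => i _; rewrite max_r// oppr_le0.
Qed.

Implicit Types u w : I -> R[i].

Lemma le_Re_normc (z : R[i]) : `|complex.Re z| <= normc z.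
Proof.
by case: z => a b /=; rewrite -sqrtr_sqr ler_wsqrtr// lerDl sqr_ge0.
Qed.

Lemma le_Im_normc (z : R[i]) : `|complex.Im z| <= normc z.
Proof.
by case: z => a b /=; rewrite -sqrtr_sqr ler_wsqrtr// lerDr sqr_ge0.
Qed.

Definition csfin u := sfin (fun i => normc (u i)).

Lemma csfin_Re u : csfin u -> sfin (fun i => `|complex.Re (u i)|).
Proof. by apply: sfin_le => i; exact: le_Re_normc. Qed.
Lemma csfin_Im u : csfin u -> sfin (fun i => `|complex.Im (u i)|).
Proof. by apply: sfin_le => i; exact: le_Im_normc. Qed.

Lemma csumD u w : csfin u -> csfin w ->
  csum (fun i => u i + w i) = csum u + csum w.
Proof.
move=> uf wf; have [Ru Iu] := (csfin_Re uf, csfin_Im uf).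
have [Rw Iw] := (csfin_Re wf, csfin_Im wf).
have E1 : rsum (fun i => complex.Re (u i + w i)) =
    rsum (fun i => complex.Re (u i)) + rsum (fun i => complex.Re (w i)).
  by rewrite -rsumD//; congr rsum; apply/funext => i; case: (u i) (w i) => ? ? [].
have E2 : rsum (fun i => complex.Im (u i + w i)) =
    rsum (fun i => complex.Im (u i)) + rsum (fun i => complex.Im (w i)).
  by rewrite -rsumD//; congr rsum; apply/funext => i; case: (u i) (w i) => ? ? [].
by rewrite /csum E1 E2.
Qed.

Lemma rsum_lin (a b : R) f g : sfin (fun i => `|f i|) -> sfin (fun i => `|g i|) ->
  rsum (fun i => a * f i + b * g i) = a * rsum f + b * rsum g.
Proof.
have sZ (k : R) h : sfin (fun i => `|h i|) -> sfin (fun i => `|k * h i|).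
  by move=> hf; apply: sfin_le (sfinZ (normr_ge0 k) _ hf) => i; rewrite ?normrM.
by move=> ff gf; rewrite rsumD ?rsumZ//; exact: sZ.
Qed.

Lemma csumZ (c : R[i]) u : csfin u -> csum (fun i => c * u i) = c * csum u.
Proof.
move=> uf; have [Rf If] := (csfin_Re uf, csfin_Im uf).
have E1 : rsum (fun i => complex.Re (c * u i)) =
    complex.Re c * rsum (fun i => complex.Re (u i)) +
    (- complex.Im c) * rsum (fun i => complex.Im (u i)).
  rewrite -rsum_lin//; congr rsum; apply/funext => i.
  by case: (c) (u i) => [a b] [p q] /=; rewrite mulNr.
have E2 : rsum (fun i => complex.Im (c * u i)) =
    complex.Re c * rsum (fun i => complex.Im (u i)) +
    complex.Im c * rsum (fun i => complex.Re (u i)).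
  rewrite -rsum_lin//; congr rsum; apply/funext => i.
  by case: (c) (u i) => [a b] [p q] /=.
rewrite /csum E1 E2 mulNr; case: (c) => a b //=.
Qed.

Lemma csum_conj u : csum (fun i => (u i)^*%C) = (csum u)^*%C.
Proof.
rewrite /csum /=; congr Complex; first by congr rsum; apply/funext => i; case: (u i).
by rewrite -rsumN; congr rsum; apply/funext => i; case: (u i).
Qed.

End ComplexSums.

(** * The inner product space l^2 *)
Section Geometry.
Variables (R : realType) (I : choiceType).
Implicit Types (x y z : hilbert R I) (c : R[i]).

Definition sqn x : R := tsum (fun i => normc (x i) ^+ 2).

Lemma sqn_fin x : sfin (fun i => normc (x i) ^+ 2).
Proof. exact/ell2P/hvalP. Qed.

Lemma hilbertP x y : (forall i, x i = y i) -> x = y.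
Proof. by move=> xy; apply/val_inj/funext. Qed.

Lemma coordD x y i : (x + y) i = x i + y i. Proof. by []. Qed.
Lemma coordZ c x i : (c *: x) i = c * x i. Proof. by []. Qed.
Lemma coord_sum (J : Type) (s : seq J) (h : J -> hilbert R I) i :
  (\sum_(j <- s) h j) i = \sum_(j <- s) h j i.
Proof. by elim/big_rec2: _ => // j a b _ <-. Qed.

Lemma sqn_ge0 x : 0 <= sqn x.
Proof. by apply: tsum_ge0 => i; exact: sqr_ge0. Qed.

Lemma hnormE x : hnorm x = Num.sqrt (sqn x). Proof. by []. Qed.

Lemma sqr_hnorm x : hnorm x ^+ 2 = sqn x.
Proof. by rewrite hnormE sqr_sqrtr// sqn_ge0. Qed.

Lemma normc_sqr (c : R[i]) : (normc c ^+ 2)%:C%C = c * c^*%C.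
Proof.
case: c => a b /=; rewrite sqr_sqrtr ?addr_ge0 ?sqr_ge0//.
by apply/eqP; rewrite eq_complex /=; apply/andP; split; apply/eqP; ring.
Qed.

Lemma normc_conj (c : R[i]) : normc c^*%C = normc c.
Proof. by case: c => a b /=; rewrite sqrrN. Qed.

Lemma sqn_coord x i : normc (x i) ^+ 2 <= sqn x.
Proof.
rewrite -lee_fin /sqn -esumT_tsum; [|by move=> j; exact: sqr_ge0|exact: sqn_fin].
rewrite -(esum_set1 (a := fun j => (normc (x j) ^+ 2)%:E)) ?lee_fin ?sqr_ge0//.
rewrite [leLHS]esum_mkcond; apply: le_esum => j _; case: ifP => //.
by rewrite lee_fin sqr_ge0.
Qed.

Lemma inner_fin x y : csfin (fun i => x i * (y i)^*%C).
Proof.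
have n2 (f : I -> R[i]) i : 0 <= normc (f i) ^+ 2 by exact: sqr_ge0.
apply: sfin_le (sfinD (n2 _) (n2 _) (sqn_fin x) (sqn_fin y)) => i.
rewrite normcM normc_conj; move: (normc_ge0 (x i)) (normc_ge0 (y i)).
by move: (normc _) (normc _) => a b a0 b0; nra.
Qed.

Lemma real_complexM (a b : R) : (a * b)%:C%C = a%:C%C * b%:C%C.
Proof. exact: rmorphM. Qed.

Lemma real_complexB (a b : R) : (a - b)%:C%C = a%:C%C - b%:C%C.
Proof. exact: rmorphB. Qed.

Lemma conjcD (a b : R[i]) : (a + b)^*%C = a^*%C + b^*%C.
Proof. exact: rmorphD. Qed.

Lemma conjcM (a b : R[i]) : (a * b)^*%C = a^*%C * b^*%C.
Proof. exact: rmorphM. Qed.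

Lemma innerDl x y z : inner (x + y) z = inner x z + inner y z.
Proof.
rewrite /inner -csumD; [|exact: inner_fin..].
by congr csum; apply/funext => i; rewrite -mulrDl.
Qed.

Lemma innerZl c x z : inner (c *: x) z = c * inner x z.
Proof.
rewrite /inner -csumZ; last exact: inner_fin.
by congr csum; apply/funext => i; rewrite mulrA.
Qed.

Lemma inner_conj x y : (inner x y)^*%C = inner y x.
Proof.
rewrite /inner -csum_conj; congr csum; apply/funext => i.
by rewrite rmorphM /= conjcK mulrC.
Qed.

Lemma normc_innerC x y : normc (inner x y) = normc (inner y x).
Proof. by rewrite -inner_conj normc_conj. Qed.

Lemma innerNl x z : inner (- x) z = - inner x z.
Proof. by rewrite -scaleN1r innerZl mulN1r. Qed.

Lemma innerBl x y z : inner (x - y) z = inner x z - inner y z.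
Proof. by rewrite innerDl innerNl. Qed.

Lemma inner0l z : inner 0 z = 0.
Proof. by rewrite -(scale0r 0) innerZl mul0r. Qed.

Lemma innerDr x y z : inner z (x + y) = inner z x + inner z y.
Proof. by rewrite -inner_conj innerDl conjcD !inner_conj. Qed.

Lemma innerZr c x z : inner z (c *: x) = c^*%C * inner z x.
Proof. by rewrite -inner_conj innerZl conjcM inner_conj. Qed.

Lemma conjcN1 : (-1 : R[i])^*%C = -1.
Proof. by rewrite rmorphN rmorph1. Qed.

Lemma innerBr x y z : inner z (x - y) = inner z x - inner z y.
Proof. by rewrite innerDr -scaleN1r innerZr conjcN1 mulN1r. Qed.

Lemma csum_ge0 (f : I -> R) : (forall i, 0 <= f i) ->
  csum (fun i => (f i)%:C%C) = (tsum f)%:C%C.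
Proof.
move=> f0; rewrite /csum /= rsum_ge0E//; congr Complex.
by rewrite rsum_ge0E // /tsum /esumT esum1.
Qed.

Lemma inner_self x : inner x x = (sqn x)%:C%C.
Proof.
rewrite -csum_ge0 => [|i]; last exact: sqr_ge0.
by congr csum; apply/funext => i; rewrite normc_sqr.
Qed.

Lemma sqnZ c x : sqn (c *: x) = normc c ^+ 2 * sqn x.
Proof.
apply: (@complexI R); rewrite -inner_self innerZl innerZr inner_self mulrA.
by rewrite -normc_sqr [RHS]real_complexM.
Qed.

Lemma sqnD_le x y : sqn (x + y) <= 2 * sqn x + 2 * sqn y.
Proof.
have two0 : (0 : R) <= 2 by [].
have n2 (z : hilbert R I) i : 0 <= normc (z i) ^+ 2 by exact: sqr_ge0.
have n22 (z : hilbert R I) i : 0 <= 2 * normc (z i) ^+ 2 by rewrite mulr_ge0.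
rewrite /sqn -!tsumZ//; [|exact: sqn_fin..].
rewrite -tsumD//; [|exact/sfinZ/sqn_fin..].
apply: tsum_le => [i|]; last by apply: sfinD => //; exact/sfinZ/sqn_fin.
rewrite n2/=; have := le_normcD (x i) (y i).
rewrite -[x i + y i]/((x + y) i).
move: (normc_ge0 ((x + y) i)) (normc_ge0 (x i)) (normc_ge0 (y i)).
move: (normc ((x + y) i)) (normc (x i)) (normc (y i)) => a b c a0 b0 c0 abc.
apply: (@le_trans _ _ ((b + c) ^+ 2)); first by rewrite lerXn2r ?nnegrE ?addr_ge0.
by have := sqr_ge0 (b - c); nra.
Qed.

Lemma sqn_eq0 x : sqn x = 0 -> x = 0.
Proof.
move=> x0; apply: hilbertP => i; apply: eq0_normc.
have := sqn_coord x i; rewrite x0 => h.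
by apply/eqP; rewrite -sqrf_eq0 eq_le h sqr_ge0.
Qed.

(** Expand the squared norm of |y|^2 x - <x,y> y. *)
Lemma cauchy_schwarz x y : normc (inner x y) ^+ 2 <= sqn x * sqn y.
Proof.
have [y0|yn0] := eqVneq (sqn y) 0.
  rewrite (sqn_eq0 y0) -inner_conj inner0l normc_conj normc0 expr0n/=.
  by rewrite mulr_ge0 ?sqn_ge0.
have yp : 0 < sqn y by rewrite lt_def yn0 sqn_ge0.
set b := sqn y in yn0 yp *; set s := inner x y; set a := sqn x.
have : sqn (b%:C%C *: x - s *: y) = b * (b * a - normc s ^+ 2).
  apply: (@complexI R); rewrite -inner_self innerBl !innerBr !innerZl !innerZr.
  rewrite !inner_self -/a -/b -(inner_conj x y) -/s real_complexM real_complexB.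
  by rewrite normc_sqr real_complexM conjc_real; ring.
move=> h; have := sqn_ge0 (b%:C%C *: x - s *: y).
by rewrite h pmulr_rge0// subr_ge0 mulrC.
Qed.

Lemma sqn_basis i : sqn (basis i : hilbert R I) = 1.
Proof.
by apply: (@complexI R); rewrite -inner_self inner_basis /= eqxx.
Qed.

End Geometry.

(** * Bounded operators and their adjoints *)
Section BoundedOperators.
Variables (R : realType) (I : choiceType).
Local Notation H := (hilbert R I).
Implicit Types (x y z : H) (T S : H -> H) (c : R).

Lemma bounded_opP T :
  bounded_op T <-> linear T /\ exists2 c, 0 <= c & forall x, sqn (T x) <= c * sqn x.
Proof.
split=> -[lT [c]].
  move=> hc; split=> //; exists (c ^+ 2); first exact: sqr_ge0.
  move=> x; rewrite -!sqr_hnorm -exprMn.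
  have hT := hc x; have T0 : 0 <= hnorm (T x) by exact: sqrtr_ge0.
  by rewrite lerXn2r// nnegrE; exact: le_trans hT.
move=> c0 hc; split=> //; exists (Num.sqrt c) => x.
by rewrite !hnormE -sqrtrM// ler_wsqrtr.
Qed.

Lemma bounded_linear T : bounded_op T -> linear T. Proof. by case. Qed.

Section Linear.
Variable T : H -> H.
Hypothesis lT : linear T.

Lemma linop0 : T 0 = 0.
Proof. by have := lT (-1) 0 0; rewrite scaler0 addr0 scaleN1r addNr. Qed.

Lemma linopD x y : T (x + y) = T x + T y.
Proof. by rewrite -[x in LHS]scale1r lT scale1r. Qed.

Lemma linopZ (a : R[i]) x : T (a *: x) = a *: T x.
Proof. by rewrite -[a *: x]addr0 lT linop0 addr0. Qed.

Lemma linop_sum (J : Type) (s : seq J) (h : J -> H) :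
  T (\sum_(j <- s) h j) = \sum_(j <- s) T (h j).
Proof. by elim/big_rec2: _ => [|j y z _ <-]; rewrite ?linop0 ?linopD. Qed.

End Linear.

Lemma inner_suml (J : Type) (s : seq J) (h : J -> H) y :
  inner (\sum_(j <- s) h j) y = \sum_(j <- s) inner (h j) y.
Proof. by elim/big_rec2: _ => [|j a z _ <-]; rewrite ?inner0l ?innerDl. Qed.

Lemma bounded_id : bounded_op (id : H -> H).
Proof. by apply/bounded_opP; split=> //; exists 1 => // x; rewrite mul1r. Qed.

Lemma bounded_add T S : bounded_op T -> bounded_op S ->
  bounded_op (fun x => T x + S x).
Proof.
move=> /bounded_opP[lT [c c0 hT]] /bounded_opP[lS [d d0 hS]].
apply/bounded_opP; split.
  by move=> a x y; rewrite lT lS scalerDr addrACA.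
exists (2 * c + 2 * d) => [|x]; first by rewrite addr_ge0// mulr_ge0.
apply: le_trans (sqnD_le _ _) _; have := hT x; have := hS x; nra.
Qed.

Lemma bounded_scale (a : R[i]) T : bounded_op T -> bounded_op (fun x => a *: T x).
Proof.
move=> /bounded_opP[lT [c c0 hT]]; apply/bounded_opP; split.
  by move=> b x y; rewrite lT scalerDr !scalerA mulrC.
exists (normc a ^+ 2 * c) => [|x]; first by rewrite mulr_ge0 ?sqr_ge0.
by rewrite sqnZ -[leRHS]mulrA ler_wpM2l ?sqr_ge0.
Qed.

Lemma bounded_comp T S : bounded_op T -> bounded_op S -> bounded_op (T \o S).
Proof.
move=> /bounded_opP[lT [c c0 hT]] /bounded_opP[lS [d d0 hS]].
apply/bounded_opP; split; first by move=> a x y /=; rewrite lS lT.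
exists (c * d) => [|x]; first exact: mulr_ge0.
by apply: le_trans (hT _) _; rewrite -mulrA ler_wpM2l.
Qed.

Lemma bounded_alg (A : set (H -> H)) :
  (forall T, A T -> bounded_op T) -> forall T, alg A T -> bounded_op T.
Proof.
move=> hA T; elim=> [{}T /hA//| |{}T S _ bT _ bS|a {}T _ bT|{}T S _ bT _ bS].
- exact: bounded_id.
- exact: bounded_add.
- exact: bounded_scale.
- exact: bounded_comp.
Qed.

Lemma adjoint_sym T S : adjoint T S -> adjoint S T.
Proof. by move=> TS x y; rewrite -inner_conj -TS inner_conj. Qed.

Lemma adjoint_unique T S S' : adjoint T S -> adjoint T S' -> S = S'.
Proof.
move=> h h'; apply/funext => y; apply: hilbertP => i.
by rewrite -!inner_basis -!(inner_conj (basis i)) -h -h'.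
Qed.

Lemma adjoint_linear T S : adjoint T S -> linear S.
Proof.
move=> /adjoint_sym TS a x y; apply: hilbertP => i.
by rewrite -inner_basis TS innerDl innerZl -!TS -innerZl -innerDl inner_basis.
Qed.

(** |S x|^2 = <T S x, x>, so Cauchy-Schwarz gives |S x|^4 <= c |S x|^2 |x|^2. *)
Lemma adjoint_bounded T S : bounded_op T -> adjoint T S -> bounded_op S.
Proof.
move=> /bounded_opP[_ [c c0 hT]] TS; apply/bounded_opP.
split; first exact: adjoint_linear TS.
exists c => // x; have := cauchy_schwarz (T (S x)) x.
rewrite TS inner_self /= expr0n addr0 sqrtr_sqr ger0_norm ?sqn_ge0// => h.
have h' := le_trans h (ler_wpM2r (sqn_ge0 x) (hT (S x))).
have [->|n0] := eqVneq (sqn (S x)) 0; first by rewrite mulr_ge0 ?sqn_ge0.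
have Sp : 0 < sqn (S x) by rewrite lt_def n0 sqn_ge0.
by rewrite -(ler_pM2l Sp) -expr2 mulrA [_ * c]mulrC.
Qed.

(** * Multiplication operators and truncation *)
Implicit Types (d : I -> R[i]).

(** For bounded d the product lies in l^2 and the default value is never met.
    The form with insubd makes the conditional expectation an instance of mulop
    by conversion. *)
Definition mulop d : H -> H := fun x => insubd 0 (fun u => d u * x u).

Section Mulop.
Variables (d : I -> R[i]) (c : R).
Hypothesis dc : forall u, normc (d u) <= c.

Let c0 (u : I) : 0 <= c := le_trans (normc_ge0 (d u)) (dc u).

Let le_dc x u : normc (d u * x u) ^+ 2 <= c ^+ 2 * normc (x u) ^+ 2.
Proof.
rewrite normcM exprMn ler_wpM2r ?sqr_ge0//.
by rewrite lerXn2r// nnegrE ?normc_ge0// (c0 u).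
Qed.

Let fin_dc x : sfin (fun u => c ^+ 2 * normc (x u) ^+ 2).
Proof. by apply: sfinZ (sqn_fin x) => [|i]; exact: sqr_ge0. Qed.

Lemma mulopE x u : mulop d x u = d u * x u.
Proof.
rewrite /mulop insubdK//; apply/ell2P.
by apply: sfin_le (fin_dc x) => i; exact: le_dc.
Qed.

Lemma sqn_mulop x : sqn (mulop d x) <= c ^+ 2 * sqn x.
Proof.
rewrite -tsumZ; [|exact: sqr_ge0|by move=> i; exact: sqr_ge0|exact: sqn_fin].
by apply: tsum_le => // u; rewrite mulopE sqr_ge0/=.
Qed.

Lemma mulop_bounded : bounded_op (mulop d).
Proof.
apply/bounded_opP; split.
  move=> a x y; apply: hilbertP => i.
  by rewrite coordD coordZ !mulopE coordD coordZ; ring.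
by exists (c ^+ 2) => [|x]; [exact: sqr_ge0|exact: sqn_mulop].
Qed.

Lemma mulop_adjoint : adjoint (mulop d) (mulop (fun u => (d u)^*%C)).
Proof.
have dc' u : normc ((d u)^*%C) <= c by rewrite normc_conj.
move=> x y; congr csum; apply/funext => u.
rewrite mulopE /mulop insubdK ?conjcM ?conjcK; first by ring.
apply/ell2P; apply: sfin_le (fin_dc y) => i.
by rewrite normcM normc_conj -normcM; exact: le_dc.
Qed.

End Mulop.

Definition outside (X : seq I) : H -> H := mulop (fun u => (u \notin X)%:R).

Lemma outsideE X x u : outside X x u = if u \in X then 0 else x u.
Proof.
rewrite /outside (@mulopE _ 1) => [|w]; first by case: (u \in X); rewrite ?mul0r ?mul1r.
case: (w \notin X); first by rewrite (_ : true%:R = 1) ?normc1.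
by rewrite (_ : false%:R = 0) ?normc0.
Qed.

Lemma outside_split X x :
  x = \sum_(u <- undup X) x u *: basis u + outside X x.
Proof.
apply: hilbertP => w; rewrite coordD coord_sum outsideE -mem_undup.
case: ifPn => wX.
  rewrite addr0 (bigD1_seq w) ?undup_uniq// big1 => [|u uw].
    by rewrite Monoid.mulm1 coordZ /= eqxx mulr1.
  by rewrite coordZ /= eq_sym (negbTE uw) mulr0.
rewrite big1_seq ?add0r// => u /andP[_ uX]; rewrite coordZ /=.
by case: eqP uX wX => [->->|_ _ _]; rewrite ?mulr0.
Qed.

Lemma outside_small x (eps : R) : 0 < eps ->
  exists X, sqn (outside X x) < eps.
Proof.
move=> e0; have [|X hX] := tsum_tail _ (sqn_fin x) e0; first by move=> i; exact: sqr_ge0.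
exists X; apply: le_lt_trans hX; rewrite /sqn le_eqVlt; apply/orP; left; apply/eqP.
congr tsum; apply/funext => u; rewrite outsideE; case: ifP => // _.
by rewrite normc0 expr0n.
Qed.

(** Vectors with finitely many nonzero coordinates are dense. *)
Lemma bounded_eq0 T : bounded_op T -> (forall u, T (basis u) = 0) -> T = (fun=> 0).
Proof.
move=> /bounded_opP[lT [c c0 hT]] T0; apply/funext => x; apply: sqn_eq0.
apply/eqP; rewrite eq_le sqn_ge0 andbT; apply/ler_addgt0Pr => e e0.
have e0' : 0 < e / (c + 1) by rewrite divr_gt0// ltr_wpDl.
have [X hX] := outside_small x e0'; rewrite add0r (outside_split X x).
rewrite linopD// linop_sum// big1 ?add0r => [|u _]; last by rewrite linopZ// T0 scaler0.
apply: le_trans (hT _) _; move: hX; rewrite ltr_pdivlMr ?ltr_wpDl//.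
have := sqn_ge0 (outside X x); nra.
Qed.

(** * Partial permutations of the basis *)
Section Pull.
Variable g : I -> option I.
Hypothesis g_inj : forall w w' u, g w = Some u -> g w' = Some u -> w = w'.

(** The left side is the sum of f over the image of g. *)
Lemma esumT_pull (f : I -> R) : (forall u, 0 <= f u) ->
  (esumT (fun w => oapp f 0%R (g w)) <= esumT f)%E.
Proof.
move=> f0; pose P := [set w | isSome (g w)]; pose e w := odflt w (g w).
have eP : set_inj P e.
  move=> w w' /set_mem + /set_mem; rewrite /P /e /=.
  case Ew : (g w) => [u|//]; case Ew' : (g w') => [u'|//] _ _ /= uu'.
  by apply: g_inj Ew _; rewrite uu'.
have -> : esumT (fun w => oapp f 0 (g w)) = \esum_(w in P) (f (e w))%:E.
  rewrite [RHS]esum_mkcond; apply: eq_esum => w _; rewrite /P /e.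
  case: ifPn => [/set_mem/=|]; first by case: (g w).
  by rewrite notin_setE /=; case: (g w).
rewrite -(esum_image P e (fun u => (f u)%:E))// [leLHS]esum_mkcond.
by apply: le_esum => u _; case: ifP => //; rewrite lee_fin f0.
Qed.

(** The operator that sends the basis vector of g w to that of w, and the basis
    vectors outside the image of g to 0.  Creation and annihilation operators,
    and the operators of the commutants used below, all have this form. *)
Definition pull : H -> H := fun x => insubd 0 (fun w => oapp (hval x) 0 (g w)).

Let pull_sq x w : normc (oapp (hval x) 0 (g w)) ^+ 2 =
  oapp (fun u => normc (x u) ^+ 2) 0 (g w).
Proof.
by case: (g w) => [//|]; rewrite -[LHS]/(normc 0 ^+ 2) normc0 expr0n.
Qed.

Lemma pullE x w : pull x w = oapp (hval x) 0 (g w).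
Proof.
rewrite /pull insubdK//; apply/ell2P; apply: le_lt_trans (sqn_fin x).
rewrite (eq_esum (b := fun w => (oapp (fun u => normc (x u) ^+ 2) 0 (g w))%:E)).
  by apply: esumT_pull => u; exact: sqr_ge0.
by move=> {}w _; rewrite pull_sq.
Qed.

Lemma pull_bounded : bounded_op pull.
Proof.
apply/bounded_opP; split.
  move=> a x y; apply: hilbertP => w; rewrite coordD coordZ !pullE.
  by case: (g w) => //=; rewrite mulr0 addr0.
exists 1 => // x; rewrite mul1r -lee_fin /sqn.
rewrite -!esumT_tsum//; try exact: sqn_fin; try by move=> i; exact: sqr_ge0.
rewrite /esumT (eq_esum (b := fun w => (oapp (fun u => normc (x u) ^+ 2) 0 (g w))%:E)).
  by apply: esumT_pull => u; exact: sqr_ge0.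
by move=> w _; rewrite pullE pull_sq.
Qed.

End Pull.

(** Composition of such operators is composition of the partial maps, in the
    reverse order. *)
Lemma pull_commute (g h : I -> option I) (C S : H -> H) :
  (forall x w, C x w = oapp (hval x) 0 (g w)) ->
  (forall x w, S x w = oapp (hval x) 0 (h w)) ->
  (forall w, obind g (h w) = obind h (g w)) ->
  forall x, S (C x) = C (S x).
Proof.
move=> CE SE gh x; apply: hilbertP => w; rewrite CE SE.
have -> : oapp (hval (C x)) 0 (h w) = oapp (hval x) 0 (obind g (h w)).
  by case: (h w) => //= u; rewrite CE.
rewrite gh; case: (g w) => //= u; by rewrite SE.
Qed.

Lemma option_ext (X : Type) (a b : option X) :
  (forall k : X, a = Some k <-> b = Some k) -> a = b.
Proof.
case: a b => [a|] [b|] h //; first by rewrite ((h a).1 erefl).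
  by have := (h a).1 erefl.
by have := (h b).2 erefl.
Qed.

Lemma obindP (X Y : Type) (h : X -> option Y) (o : option X) (t : Y) :
  (obind h o = Some t) <-> (exists2 s, o = Some s & h s = Some t).
Proof.
split; first by case: o => [s|//] /= hs; exists s.
by case=> s -> /= ->.
Qed.

Lemma oapp_obind (X Y V : Type) (h : X -> option Y) (f : Y -> V) (v : V)
    (o : option X) :
  oapp (fun s => oapp f v (h s)) v o = oapp f v (obind h o).
Proof. by case: o. Qed.

Section PartialBijection.
Variables f g : I -> option I.
Hypothesis fg : forall u w, f u = Some w <-> g w = Some u.

Lemma esumT_pbij (k : I -> I -> R) : (forall u w, 0 <= k u w) ->
  esumT (fun u => oapp (k u) 0 (f u)) = esumT (fun w => oapp (k^~ w) 0 (g w)).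
Proof.
move=> k0; pose P := [set u | isSome (f u)]; pose Q := [set w | isSome (g w)].
pose e u := odflt u (f u); pose e' w := odflt w (g w).
have -> : esumT (fun u => oapp (k u) 0 (f u)) = \esum_(u in P) (k u (e u))%:E.
  rewrite [RHS]esum_mkcond; apply: eq_esum => u _; rewrite /P /e.
  case: ifPn => [/set_mem/=|]; first by case: (f u).
  by rewrite notin_setE /=; case: (f u).
have -> : esumT (fun w => oapp (k^~ w) 0 (g w)) = \esum_(w in Q) (k (e' w) w)%:E.
  rewrite [RHS]esum_mkcond; apply: eq_esum => u _; rewrite /Q /e'.
  case: ifPn => [/set_mem/=|]; first by case: (g u).
  by rewrite notin_setE /=; case: (g u).
have fP u : P u -> f u = Some (e u) by rewrite /P /e /=; case: (f u).
have gQ w : Q w -> g w = Some (e' w) by rewrite /Q /e' /=; case: (g w).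
rewrite (reindex_esum P Q e); last first.
  split=> [u Pu|u u' /set_mem Pu /set_mem Pu' ee|w Qw].
  - by rewrite /Q /=; have /fg -> := fP u Pu.
  - have /fg gu := fP _ Pu; have /fg gu' := fP _ Pu'.
    by move: gu; rewrite ee gu' => -[].
  - have /fg fw := gQ _ Qw; exists (e' w); first by rewrite /P /= fw.
    by rewrite /e fw.
by apply: eq_esum => u Pu; rewrite /e' ((fg _ _).1 (fP u Pu)).
Qed.

Lemma csum_pbij (k : I -> I -> R[i]) :
  csum (fun u => oapp (k u) 0 (f u)) = csum (fun w => oapp (k^~ w) 0 (g w)).
Proof.
have rsum_pbij (h : I -> I -> R) :
    rsum (fun u => oapp (h u) 0 (f u)) = rsum (fun w => oapp (h^~ w) 0 (g w)).
  have := @esumT_pbij (fun u w => Num.max (- h u w) 0).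
  have := @esumT_pbij (fun u w => Num.max (h u w) 0).
  move=> E1 E2; rewrite /rsum; congr (fine _ - fine _).
  - rewrite (eq_esum (b := fun u => (oapp (fun w => Num.max (h u w) 0) 0 (f u))%:E)).
      rewrite [LHS]E1 => [|u w]; last exact: maxr0_ge0.
      by apply: eq_esum => w _; case: (g w) => //=; rewrite maxxx.
    by move=> u _; case: (f u) => //=; rewrite maxxx.
  - rewrite (eq_esum (b := fun u => (oapp (fun w => Num.max (- h u w) 0) 0 (f u))%:E)).
      rewrite [LHS]E2 => [|u w]; last exact: maxr0_ge0.
      by apply: eq_esum => w _; case: (g w) => //=; rewrite oppr0 maxxx.
    by move=> u _; case: (f u) => //=; rewrite oppr0 maxxx.
rewrite /csum; congr Complex.
  transitivity (rsum (fun u => oapp (fun w => complex.Re (k u w)) 0 (f u))).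
    by congr rsum; apply/funext => u; case: (f u).
  by rewrite rsum_pbij; congr rsum; apply/funext => w; case: (g w).
transitivity (rsum (fun u => oapp (fun w => complex.Im (k u w)) 0 (f u))).
  by congr rsum; apply/funext => u; case: (f u).
by rewrite rsum_pbij; congr rsum; apply/funext => w; case: (g w).
Qed.

Lemma pbij_inj w w' u : g w = Some u -> g w' = Some u -> w = w'.
Proof. by move=> /fg E /fg; rewrite E => -[]. Qed.

Lemma pbij_injV w w' u : f w = Some u -> f w' = Some u -> w = w'.
Proof. by move=> /fg E /fg; rewrite E => -[]. Qed.

Lemma pull_adjoint : adjoint (pull f) (pull g).
Proof.
move=> x y; rewrite /inner.
transitivity (csum (fun u => oapp (fun w => x w * (y u)^*%C) 0 (f u))).
  congr csum; apply/funext => u; rewrite pullE; last exact: pbij_injV.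
  by case: (f u) => //=; rewrite mul0r.
rewrite csum_pbij; congr csum; apply/funext => w; rewrite pullE; last exact: pbij_inj.
by case: (g w) => [//|]; rewrite -[RHS]/(x w * 0^*%C) conjc0 mulr0.
Qed.

End PartialBijection.

End BoundedOperators.

(** * Weak closures of selfadjoint algebras *)
Section WeakClosure.
Variables (R : realType) (I : choiceType).
Local Notation H := (hilbert R I).
Implicit Types (x y : H) (T S : H -> H) (A B N : set (H -> H)).

Lemma wclosure_bounded A T : wclosure A T -> bounded_op T. Proof. by case. Qed.

Lemma wclosure_mono A B : A `<=` B -> wclosure A `<=` wclosure B.
Proof.
by move=> AB T [bT hT]; split=> // s e /(hT s)[S /AB BS hS]; exists S.
Qed.

Lemma normc_split (a b : R[i]) (e : R) :
  normc a < e / 2 -> normc b < e / 2 -> normc (a + b) < e.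
Proof. by move=> ha hb; have := le_normcD a b; lra. Qed.

Lemma sub_wclosure A : (forall T, A T -> bounded_op T) -> A `<=` wclosure A.
Proof.
move=> bA T AT; split; first exact: bA.
by move=> s e e0; exists T => // p _; rewrite subrr inner0l normc0.
Qed.

Lemma wclosure_idem A : wclosure (wclosure A) = wclosure A.
Proof.
apply/seteqP; split; last by apply: sub_wclosure => T [].
move=> T [bT hT]; split=> // s e e0; have e20 : 0 < e / 2 by rewrite divr_gt0.
have [S [_ hS] ST] := hT s _ e20; have [U AU US] := hS s _ e20.
exists U => // p ps; rewrite -(subrKA (S p.1)) innerDl.
by apply: normc_split; [exact: ST|exact: US].
Qed.

Lemma alg_least A N : A `<=` N -> N id ->
  (forall T S, N T -> N S -> N (fun x => T x + S x)) ->
  (forall c T, N T -> N (fun x => c *: T x)) ->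
  (forall T S, N T -> N S -> N (T \o S)) -> alg A `<=` N.
Proof.
by move=> AN N1 ND NZ NM T; elim=> *;
  [exact: AN|exact: N1|exact: ND|exact: NZ|exact: NM].
Qed.

Lemma alg_mono A B : A `<=` B -> alg A `<=` alg B.
Proof.
move=> AB; apply: alg_least => [T /AB/alg_gen//||T S|c T|T S].
- exact: alg_one.
- exact: alg_add.
- exact: alg_scale.
- exact: alg_mul.
Qed.

(** Closure under adjoints, with existence of the adjoints included: they are
    needed as operators to move a factor across the inner product. *)
Definition starred A := forall T, A T ->
  bounded_op T /\ exists2 S, A S & adjoint T S.

Lemma alg_adjoint A T : starred A -> alg A T -> exists2 S, alg A S & adjoint T S.
Proof.
move=> sA; elim=> [{}T AT| |{}T S _ [T' AT' hT] _ [S' AS' hS]|c {}T _ [T' AT' hT]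
  |{}T S _ [T' AT' hT] _ [S' AS' hS]].
- by have [_ [S AS TS]] := sA _ AT; exists S => //; exact: alg_gen.
- by exists id => //; exact: alg_one.
- exists (fun x => T' x + S' x); first exact: alg_add.
  by move=> x y; rewrite innerDl innerDr hT hS.
- exists (fun x => c^*%C *: T' x); first exact: alg_scale.
  by move=> x y; rewrite innerZl innerZr conjcK hT.
- exists (S' \o T'); first exact: alg_mul.
  by move=> x y /=; rewrite hT hS.
Qed.

Section Starred.
Variable A : set (H -> H).
Hypothesis sA : starred A.
Local Notation N := (wclosure (alg A)).

Lemma starred_bounded T : alg A T -> bounded_op T.
Proof. by apply: bounded_alg => S /sA[]. Qed.

Lemma sub_wclosure_alg : alg A `<=` N.
Proof. exact/sub_wclosure/starred_bounded. Qed.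

Lemma wclosure_adjoint T S : N T -> adjoint T S -> N S.
Proof.
move=> [bT hT] TS; split; first exact: adjoint_bounded TS.
move=> s e e0; have [T' AT' hT'] := hT [seq (p.2, p.1) | p <- s] e e0.
have [S' AS' TS'] := alg_adjoint sA AT'; exists S' => // p ps.
rewrite normc_innerC innerBr -TS -TS' -innerBl.
by apply: (hT' (p.2, p.1)); apply: map_f ps.
Qed.

Lemma wclosure_add T S : N T -> N S -> N (fun x => T x + S x).
Proof.
move=> [bT hT] [bS hS]; split; first exact: bounded_add.
move=> s e e0; have e20 : 0 < e / 2 by rewrite divr_gt0.
have [T' AT' hT'] := hT s _ e20; have [S' AS' hS'] := hS s _ e20.
exists (fun x => T' x + S' x) => [|p ps]; first exact: alg_add.
by rewrite opprD addrACA innerDl; apply: normc_split; [exact: hT'|exact: hS'].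
Qed.

Lemma wclosure_scale c T : N T -> N (fun x => c *: T x).
Proof.
move=> [bT hT]; split; first exact: bounded_scale.
move=> s e e0; have c0 : 0 < normc c + 1 by rewrite ltr_wpDl ?normc_ge0.
have [T' AT' hT'] := hT s _ (divr_gt0 e0 c0).
exists (fun x => c *: T' x) => [|p ps]; first exact: alg_scale.
rewrite -scalerBr innerZl normcM; have := hT' p ps; rewrite ltr_pdivlMr//.
have := normc_ge0 (inner (T p.1 - T' p.1) p.2); have := normc_ge0 c; nra.
Qed.

(** First replace T by T' in the algebra, testing on the vectors S x; then
    replace S, testing against the adjoint of T', which is available because
    T' is now in the algebra. *)
Lemma wclosure_mul T S : N T -> N S -> N (T \o S).
Proof.
move=> [bT hT] [bS hS]; split; first exact: bounded_comp.
move=> s e e0; have e20 : 0 < e / 2 by rewrite divr_gt0.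
have [T' AT' hT'] := hT [seq (S p.1, p.2) | p <- s] _ e20.
have [T'' AT'' TT] := alg_adjoint sA AT'.
have [S' AS' hS'] := hS [seq (p.1, T'' p.2) | p <- s] _ e20.
exists (T' \o S') => [|p ps]; first exact: alg_mul.
rewrite -(subrKA (T' (S p.1))) innerDl; apply: normc_split.
  by apply: (hT' (S p.1, p.2)); exact: (map_f (fun p => (S p.1, p.2))).
rewrite innerBl [(T' \o S') _]/= !TT -innerBl.
by apply: (hS' (p.1, T'' p.2)); exact: (map_f (fun p => (p.1, T'' p.2))).
Qed.

(** The weak closure is an algebra closed under adjoints, and weak closure is
    idempotent. *)
Lemma wstar_wclosure_alg : wstar N = N.
Proof.
apply/seteqP; split; last first.
  apply: subset_trans (sub_wclosure _) => [|T].
    by move=> T NT; apply: alg_gen; left.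
  apply: bounded_alg => S [[]//|[U NU US]].
  by apply: adjoint_bounded US; exact: wclosure_bounded NU.
rewrite -[X in _ `<=` X]wclosure_idem; apply: wclosure_mono.
apply: alg_least => [T [//|[S NS ST]]||||].
- exact: wclosure_adjoint ST.
- by apply: sub_wclosure_alg; exact: alg_one.
- exact: wclosure_add.
- exact: wclosure_scale.
- exact: wclosure_mul.
Qed.

End Starred.

Lemma starred_adjoints A :
  (forall T, A T -> bounded_op T /\ exists S, adjoint T S) ->
  starred (A `|` adjoints A).
Proof.
move=> hA T [AT|[S AS ST]].
  by have [bT [S TS]] := hA _ AT; split=> //; exists S => //; right; exists T.
split; first by apply: adjoint_bounded ST; case: (hA _ AS).
by exists S; [left|exact: adjoint_sym].
Qed.

Lemma wstar_mono A B : A `<=` B -> wstar A `<=` wstar B.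
Proof.
move=> AB; apply/wclosure_mono/alg_mono => T [/AB|[S /AB BS ST]]; first by left.
by right; exists S.
Qed.

Lemma wstar_least A N : A `<=` N -> wstar N = N -> wstar A `<=` N.
Proof. by move=> AN <-; exact: wstar_mono. Qed.

Lemma wstar_idem A :
  (forall T, A T -> bounded_op T /\ exists S, adjoint T S) ->
  wstar (wstar A) = wstar A.
Proof. by move=> /starred_adjoints/wstar_wclosure_alg. Qed.

Lemma sub_wstar A :
  (forall T, A T -> bounded_op T /\ exists S, adjoint T S) -> A `<=` wstar A.
Proof.
move=> /starred_adjoints sA T AT; apply: sub_wclosure_alg => //.
by apply: alg_gen; left.
Qed.

Section Commutant.
Variables (g : I -> option I) (C : H -> H).
Hypothesis CE : forall x w, C x w = oapp (hval x) 0 (g w).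

(** Commutation with an operator whose matrix has at most one nonzero entry in
    each row passes to weak limits, because each coordinate of C T x is a single
    coordinate of T x. *)
Lemma commute_wclosure A : (forall T x, A T -> T (C x) = C (T x)) ->
  forall T x, wclosure (alg A) T -> T (C x) = C (T x).
Proof.
move=> hA T x.
have CD y z : C (y + z) = C y + C z.
  apply: hilbertP => w; rewrite coordD !CE; case: (g w) => //=.
  by rewrite addr0.
have CZ c y : C (c *: y) = c *: C y.
  by apply: hilbertP => w; rewrite coordZ !CE; case: (g w) => //=; rewrite mulr0.
have {}hA : alg A `<=` [set S | forall y, S (C y) = C (S y)].
  apply: alg_least => [S AS y|//|S U hS hU y|c S hS y|S U hS hU y] /=.
  - exact: hA.
  - by rewrite hS hU CD.
  - by rewrite hS CZ.
  - by rewrite hU hS.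
move=> [bT hT]; apply: hilbertP => w; rewrite CE; apply/eqP; rewrite -subr_eq0.
apply/eqP/eq0_normc/eqP; rewrite eq_le normc_ge0 andbT.
apply/ler_addgt0Pr => e e0; rewrite add0r; have e20 : 0 < e / 2 by rewrite divr_gt0.
pose y : H := oapp (fun u => basis u) 0 (g w).
have [S /hA/= SC hS] := hT [:: (C x, basis w); (x, y)] _ e20.
have h2 : normc (inner (T (C x) - S (C x)) (basis w)) < e / 2.
  by apply: (hS (C x, basis w)); rewrite mem_head.
have h1 : normc (inner (T x - S x) y) < e / 2.
  by apply: (hS (x, y)); rewrite inE mem_head orbT.
move: h1 h2; rewrite !innerBl !inner_basis SC CE => h1 h2; apply: ltW.
have yE z : inner z y = oapp (hval z) 0 (g w).
  rewrite /y; case: (g w) => [u|] /=; first by rewrite inner_basis.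
  by rewrite -inner_conj inner0l conjc0.
rewrite !yE in h1; rewrite -(subrKA (oapp (hval (S x)) 0 (g w))).
by apply: normc_split => //; rewrite -normcN opprB.
Qed.

End Commutant.
End WeakClosure.

(** * Diagonal operators on small tails *)
Section SmallTails.
Variables (R : realType) (I : choiceType).
Local Notation H := (hilbert R I).
Implicit Types (x y : H) (e : I -> R[i]).

Lemma mulop_basis e (c : R) i : (forall u, normc (e u) <= c) ->
  mulop e (basis i) = e i *: basis i :> H.
Proof.
move=> ec; apply: hilbertP => u; rewrite coordZ (mulopE ec) /=.
by case: eqP => [->//|_]; rewrite !mulr0.
Qed.

Lemma normc_lt_sqr (a : R[i]) (e : R) : 0 < e -> normc a ^+ 2 < e ^+ 2 -> normc a < e.
Proof. by move=> e0; rewrite ltr_pXn2r// nnegrE ?normc_ge0// ltW. Qed.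

(** One finite set X serves all multipliers bounded by c, as normality
    requires. *)
Lemma mulop_outside_small x y (c eps : R) : 0 < eps ->
  exists X, forall e, (forall u, normc (e u) <= c) ->
    normc (inner (mulop e (outside X x)) y) < eps.
Proof.
move=> e0; have k0 : 0 < (c ^+ 2 + 1) * (sqn y + 1).
  by rewrite mulr_gt0// ltr_wpDl ?sqr_ge0 ?sqn_ge0.
have [X hX] := outside_small x (divr_gt0 (exprn_gt0 2 e0) k0).
exists X => e ec; apply: normc_lt_sqr => //.
apply: le_lt_trans (cauchy_schwarz _ _) _.
apply: (@le_lt_trans _ _ ((c ^+ 2 * sqn (outside X x)) * sqn y)).
  by rewrite ler_wpM2r ?sqn_ge0// sqn_mulop.
move: hX; rewrite ltr_pdivlMr//.
move: (sqn_ge0 (outside X x)) (sqn_ge0 y) (sqr_ge0 c).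
move: (sqn (outside X x)) (sqn y) (c ^+ 2) (eps ^+ 2) => a b k E a0 b0 kk h.
apply: le_lt_trans h; rewrite [k * a]mulrC -mulrA ler_wpM2l//; nra.
Qed.

Lemma normc_sum (J : Type) (s : seq J) (h : J -> R[i]) :
  normc (\sum_(j <- s) h j) <= \sum_(j <- s) normc (h j).
Proof.
elim/big_rec2: _ => [|j a b _ ab]; first by rewrite normc0.
by apply: le_trans (le_normcD _ _) _; rewrite lerD2l.
Qed.

End SmallTails.

(** * The diagonal algebra and the conditional expectation *)
Section Graph.
Variables (R : realType) (G : digraph).
Local Notation F := (fsgd G).
Local Notation H := (hilbert R F).
Local Notation D := (diag_alg R G).
Local Notation E := (cond_exp R G).
Local Notation L := (@creation R G).
Implicit Types (w u : F) (x y : H) (v : vert G) (T S : H -> H) (M : set (H -> H)).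

Definition annihilation w : H -> H := pull (concat w).

Lemma creation_pull w : @creation R G w = pull (ldiv w).
Proof.
apply/funext => x; apply: hilbertP => u; rewrite pullE//.
exact/pbij_injV/ldivP.
Qed.

Lemma creation_bounded w : bounded_op (@creation R G w).
Proof. by rewrite creation_pull; apply: pull_bounded; exact/pbij_injV/ldivP. Qed.

Lemma creation_adjoint w : adjoint (@creation R G w) (annihilation w).
Proof. by rewrite creation_pull; exact/pull_adjoint/ldivP. Qed.

Lemma annihilationE w x u : annihilation w x u = oapp (hval x) 0 (concat w u).
Proof. by apply: pullE; exact/pbij_inj/ldivP. Qed.

Lemma creation_vertex_adjoint v : adjoint (L (vertex v)) (L (vertex v)).
Proof.
move=> x y; congr csum; apply/funext => u; rewrite !creation_vertexE.
by rewrite conjcM conjc_nat; ring.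
Qed.

Lemma diag_starred : starred [set L (vertex v) | v in [set: vert G]].
Proof.
move=> _ [v _ <-]; split; first exact: creation_bounded.
by exists (L (vertex v)); [exists v|exact: creation_vertex_adjoint].
Qed.

Lemma diag_wstar : wstar D = D.
Proof. exact/wstar_wclosure_alg/diag_starred. Qed.

Lemma diag_bounded T : D T -> bounded_op T. Proof. exact: wclosure_bounded. Qed.

Lemma vcoefE T v : vcoef T v = T (basis (vertex v)) (vertex v).
Proof. exact: inner_basis. Qed.

(** T commutes with the rank one operator that maps the basis vector of u to
    that of its initial vertex v, because each L_v does; so the diagonal entry
    of T at u is the one at v. *)
Lemma diagE T x u : D T -> T x u = vcoef T (ini u) * x u.
Proof.
pose C (y : H) : H := y u *: basis (vertex (ini u)).
pose g w := if w == vertex (ini u) then Some u else None.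
have CE y w : C y w = oapp (hval y) 0 (g w).
  by rewrite coordZ /g /=; case: eqP; rewrite ?mulr1 ?mulr0.
move=> DT; have := commute_wclosure CE _ x DT.
move=> /(_ _)/(congr1 (fun y : H => y (vertex (ini u)))).
rewrite !CE /g eqxx [RHS]/= => <-; last first.
  move=> _ {}x [v _ <-]; apply: hilbertP => w; rewrite creation_vertexE !CE /g.
  case: (w =P _) => [->|_]; last by rewrite mulr0.
  by rewrite [RHS]creation_vertexE.
rewrite /C linopZ; last exact/bounded_linear/diag_bounded.
by rewrite coordZ vcoefE mulrC.
Qed.

Lemma vcoef_bound T (c : R) : (forall x, hnorm (T x) <= c * hnorm x) ->
  forall v, normc (vcoef T v) <= c.
Proof.
move=> hT v; have h := hT (basis (vertex v)).
rewrite [X in _ * X]hnormE sqn_basis sqrtr1 mulr1 in h.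
apply: le_trans h; rewrite vcoefE hnormE.
rewrite -(ger0_norm (normc_ge0 _)) -sqrtr_sqr ler_wsqrtr//.
exact: sqn_coord.
Qed.

Lemma cond_exp_mulop T : E T = mulop (fun u => vcoef T (ini u)).
Proof. by []. Qed.

Lemma cond_expE T x u : bounded_op T -> E T x u = vcoef T (ini u) * x u.
Proof.
by move=> [_ [c /vcoef_bound hc]]; rewrite cond_exp_mulop (mulopE (c := c)).
Qed.

Lemma vcoef_cond_exp0 T v : bounded_op T -> E T = (fun=> 0) -> vcoef T v = 0.
Proof.
move=> bT ET; have := cond_expE (basis (vertex v)) (vertex v) bT.
by rewrite ET /= eqxx mulr1.
Qed.

Lemma cond_exp0 T : bounded_op T -> (forall v, vcoef T v = 0) -> E T = (fun=> 0).
Proof.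
move=> bT T0; apply/funext => x; apply: hilbertP => u.
by rewrite cond_expE// T0 mul0r.
Qed.

Section DiagonalOperators.
Variables (d : vert G -> R[i]) (c : R).
Hypothesis dc : forall v, normc (d v) <= c.

(** The finite Fourier sums that approximate a diagonal operator weakly. *)
Definition diag_partial (V : seq (vert G)) : H -> H :=
  fun x => \sum_(v <- V) d v *: L (vertex v) x.

Lemma diag_partial_alg V : alg [set L (vertex v) | v in [set: vert G]] (diag_partial V).
Proof.
rewrite /diag_partial; elim: V => [|v V IH].
  rewrite [X in alg _ X](_ : _ = fun x => 0 *: id x); last first.
    by apply/funext => x; rewrite big_nil scale0r.
  exact/alg_scale/alg_one.
rewrite [X in alg _ X]
  (_ : _ = fun x => d v *: L (vertex v) x + diag_partial V x); last first.
  by apply/funext => x; rewrite big_cons.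
apply: alg_add IH; apply: alg_scale; apply: alg_gen; by exists v.
Qed.

Lemma diag_partialE V x u : uniq V ->
  diag_partial V x u = (if ini u \in V then d (ini u) else 0) * x u.
Proof.
move=> uV; rewrite coord_sum; case: ifPn => uiV.
  rewrite (bigD1_seq (ini u))// big1 => [|v vu].
    by rewrite Monoid.mulm1 coordZ creation_vertexE eqxx mul1r.
  by rewrite coordZ creation_vertexE eq_sym (negbTE vu) mul0r mulr0.
rewrite mul0r big1_seq// => v /andP[_ vV]; rewrite coordZ creation_vertexE.
by case: eqP uiV vV => [->/negPf->//|_ _ _]; rewrite mul0r mulr0.
Qed.

(** Take V to contain the initial vertices of a finite set of paths that carries
    most of x: the difference then acts only on the remaining small tail. *)
Lemma diag_partial_cvg x y (eps : R) : 0 < eps ->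
  exists V0 : seq (vert G), forall V, {subset V0 <= V} -> uniq V ->
    normc (inner (mulop (fun u => d (ini u)) x - diag_partial V x) y) < eps.
Proof.
move=> e0; have [X hX] := mulop_outside_small x y c e0.
exists (map (@ini G) X) => V XV uV.
pose e u := if ini u \in V then 0 else d (ini u).
have ec u : normc (e u) <= c.
  by rewrite /e; case: ifP => // _; rewrite normc0 (le_trans _ (dc (ini u))) ?normc_ge0.
suff -> : mulop (fun u => d (ini u)) x - diag_partial V x = mulop e (outside X x).
  exact: hX.
apply: hilbertP => u; rewrite (mulopE ec) outsideE -scaleN1r coordD coordZ.
rewrite diag_partialE// (mulopE (c := c))// /e.
case: ifPn => [uV'|uV']; first by rewrite mul0r; ring.
rewrite ifN; first by ring.
by apply: contraNN uV' => uX; exact/XV/map_f.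
Qed.

(** Every bounded function of the initial vertex gives an element of D_G, so E
    takes its values in D_G. *)
Lemma diag_mulop : D (mulop (fun u => d (ini u))).
Proof.
split; first by apply: (mulop_bounded (c := c)) => u.
move=> s eps e0.
suff [V0 hV0] : exists V0 : seq (vert G), forall V, {subset V0 <= V} -> uniq V ->
    forall p, p \in s ->
    normc (inner (mulop (fun u => d (ini u)) p.1 - diag_partial V p.1) p.2) < eps.
  exists (diag_partial (undup V0)); first exact: diag_partial_alg.
  by apply: hV0 (undup_uniq _) => v; rewrite mem_undup.
elim: s => [|[x y] s [V1 h1]]; first by exists [::].
have [V2 h2] := diag_partial_cvg x y e0; exists (V1 ++ V2) => V hV uV p.
rewrite inE => /predU1P[->|ps].
  by apply: h2 => // v vV; apply: hV; rewrite mem_cat vV orbT.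
by apply: h1 ps => // v vV; apply: hV; rewrite mem_cat vV.
Qed.

End DiagonalOperators.

Lemma cond_exp_range T : bounded_op T -> D (E T).
Proof. by move=> [_ [c /vcoef_bound hc]]; exact: diag_mulop hc. Qed.

Lemma cond_exp_id T : D T -> E T = T.
Proof.
move=> DT; apply/funext => x; apply: hilbertP => u.
by rewrite cond_expE ?diagE//; exact: diag_bounded.
Qed.

Lemma cond_exp_linear (c : R[i]) T S : bounded_op T -> bounded_op S ->
  E (fun x => c *: T x + S x) = (fun x => c *: E T x + E S x).
Proof.
move=> bT bS; apply/funext => x; apply: hilbertP => u.
rewrite coordD coordZ (cond_expE _ _ bT) (cond_expE _ _ bS) cond_expE; last first.
  by apply: bounded_add => //; exact: bounded_scale.
by rewrite /vcoef innerDl innerZl; ring.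
Qed.

Lemma cond_exp_bimodule d T d' : D d -> bounded_op T -> D d' ->
  E (d \o T \o d') = d \o E T \o d'.
Proof.
move=> Dd bT Dd'; have [bd bd'] := (diag_bounded Dd, diag_bounded Dd').
apply/funext => x; apply: hilbertP => u.
rewrite cond_expE; last by apply: bounded_comp => //; exact: bounded_comp.
rewrite [RHS](diagE _ _ Dd) cond_expE// (diagE _ _ Dd').
have -> : vcoef (d \o T \o d') (ini u) =
    vcoef d (ini u) * vcoef T (ini u) * vcoef d' (ini u).
  rewrite vcoefE [LHS](diagE _ _ Dd).
  have -> : d' (basis (vertex (ini u))) = vcoef d' (ini u) *: basis (vertex (ini u)).
    apply: hilbertP => w; rewrite diagE// coordZ /=.
    by case: eqP => [->//|_]; rewrite !mulr0.
  by rewrite linopZ ?coordZ -?vcoefE; [ring|exact: bounded_linear].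
by ring.
Qed.

Lemma cond_exp_positive T : bounded_op T -> positive_op T -> positive_op (E T).
Proof.
move=> bT pT x; pose r u := complex.Re (vcoef T (ini u)) * normc (x u) ^+ 2.
have rE u : 0 <= complex.Re (vcoef T (ini u)) /\
    vcoef T (ini u) = (complex.Re (vcoef T (ini u)))%:C%C.
  have := pT (basis (vertex (ini u))); rewrite -[inner _ _]/(vcoef T (ini u)).
  by case: (vcoef _ _) => a b; rewrite lecE => /andP[/eqP/= -> ].
have r0 u : 0 <= r u by rewrite mulr_ge0 ?sqr_ge0//; case: (rE u).
have -> : inner (E T x) x = (tsum r)%:C%C.
  rewrite -csum_ge0//; congr csum; apply/funext => u.
  rewrite cond_expE// (rE u).2 /r real_complexM normc_sqr.
  by rewrite [in RHS](rE u).2 mulrA.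
by rewrite lecE /= eqxx tsum_ge0.
Qed.

(** On the finite part of x only finitely many coefficients p_v matter, and each
    is a weakly continuous functional; on the tail the norm bound suffices. *)
Lemma cond_exp_normal M : M `<=` [set T | bounded_op T] -> normal_map M E.
Proof.
move=> bM c x y eps e0; have e20 : 0 < eps / 2 by rewrite divr_gt0.
have [X hX] := mulop_outside_small x y c e20.
(* If the coefficients at the vertices below are less than delta, then the
   part of x carried by X contributes at most delta * K. *)
pose K := \sum_(u <- undup X) normc (x u) * normc (y u).
have K0 : 0 <= K by apply: sumr_ge0 => u _; rewrite mulr_ge0 ?normc_ge0.
have K1 : 0 < K + 1 by rewrite ltr_wpDl.
exists [seq (basis (vertex (ini u)), basis (vertex (ini u))) | u <- X].
exists (eps / 2 / (K + 1)); split; first exact: divr_gt0.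
move=> T /bM bT hT sT; have vc := vcoef_bound hT.
have lE : linear (E T).
  by rewrite cond_exp_mulop; apply/bounded_linear/(mulop_bounded (c := c)).
rewrite {1}(outside_split X x) linopD// linop_sum// innerDl inner_suml.
apply: normc_split; last by rewrite cond_exp_mulop; apply: hX.
apply: le_lt_trans (normc_sum _ _) _.
apply: (@le_lt_trans _ _ (eps / 2 / (K + 1) * K)); last first.
  by rewrite mulrAC ltr_pdivrMr// ltr_pM2l// ltrDl.
rewrite /K mulr_sumr big_seq [leRHS]big_seq; apply: ler_sum => u; rewrite mem_undup => uX.
rewrite linopZ// cond_exp_mulop (mulop_basis (c := c))// !innerZl inner_basisl.
rewrite !normcM normc_conj mulrCA ler_wpM2r ?mulr_ge0 ?normc_ge0// ltW//.
apply: (sT (_, _)).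
exact: (map_f (fun u => (basis (vertex (ini u)), basis (vertex (ini u)))) uX).
Qed.

(** The properties of E hold on all bounded operators, hence on any von Neumann
    algebra that contains D_G. *)
Lemma wprob_space_cond_exp M : wstar M = M -> D `<=` M -> wprob_space D M E.
Proof.
move=> MM DM.
have bM : M `<=` [set T | bounded_op T] by rewrite -MM => T /wclosure_bounded.
split=> //; first exact: diag_wstar.
split.
- by move=> T /bM/cond_exp_range.
- exact: cond_exp_id.
- by move=> c T S /bM bT /bM bS; exact: cond_exp_linear.
- by move=> d T d' Dd /bM bT Dd'; exact: cond_exp_bimodule.
- by move=> T /bM; exact: cond_exp_positive.
- exact: cond_exp_normal.
Qed.

End Graph.

(** * Factorization of paths *)
Section Paths.
Variable G : digraph.
Local Notation F := (fsgd G).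
Implicit Types (w u t : F) (e : edge G).

Lemma fsgd_eq w u : ini w = ini u -> edges w = edges u -> w = u.
Proof.
rewrite /ini /edges => i1 i2; apply: val_inj.
by rewrite [LHS]surjective_pairing i1 i2 -surjective_pairing.
Qed.

Lemma concatP w w' u : (concat w w' = Some u) <->
  [/\ fin w = ini w', ini u = ini w & edges u = edges w ++ edges w'].
Proof.
rewrite /concat; split.
  case: ifP => // /eqP fw; case: insubP => // z _ Ez [<-].
  by split=> //; rewrite /ini /edges Ez.
case=> fw iu eu; rewrite fw eqxx -iu -eu.
by rewrite (_ : (_, _) = val u) ?valK// [RHS]surjective_pairing.
Qed.

Lemma concat_exists w w' : fin w = ini w' -> exists u, concat w w' = Some u.
Proof.
move=> fw; suff p : is_path (ini w, edges w ++ edges w').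
  by exists (Fsgd p); apply/concatP.
rewrite /is_path /= admissible_cat; apply/andP; split; first exact: (valP w).
by rewrite -/(fin w) fw; exact: (valP w').
Qed.

Lemma concat_ini w w' u : concat w w' = Some u -> ini u = ini w.
Proof. by move=> /concatP[]. Qed.

Lemma concat_edges w w' u : concat w w' = Some u -> edges u = edges w ++ edges w'.
Proof. by move=> /concatP[]. Qed.

Lemma concat_fin w w' u : concat w w' = Some u -> fin u = fin w'.
Proof.
by move=> /concatP[fw iu eu]; rewrite /fin iu eu map_cat last_cat -/(fin w) fw.
Qed.

Lemma concat_injl w1 w2 u t : concat w1 u = Some t -> concat w2 u = Some t -> w1 = w2.
Proof.
move=> /concatP[_ i1 e1] /concatP[_ i2 e2]; apply: fsgd_eq; first by rewrite -i1 i2.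
have /eqP : edges w1 ++ edges u = edges w2 ++ edges u by rewrite -e1 e2.
rewrite eqseq_cat ?eqxx ?andbT => [/eqP//|].
by apply/eqP; rewrite -(eqn_add2r (size (edges u))) -!size_cat -e1 e2.
Qed.

Lemma concat_assoc w1 w2 w12 w3 t : concat w1 w2 = Some w12 ->
  (concat w12 w3 = Some t) <->
  (exists2 w23, concat w2 w3 = Some w23 & concat w1 w23 = Some t).
Proof.
move=> c12; have f12 := concat_fin c12; have [f1 i12 e12] := (concatP _ _ _).1 c12.
split=> [/concatP[f3 it et]|[w23 c23]].
  have [w23 c23] : exists w23, concat w2 w3 = Some w23.
    by apply: concat_exists; rewrite -f12.
  have [f2 i23 e23] := (concatP _ _ _).1 c23.
  exists w23 => //; apply/concatP; split; rewrite ?it ?i23//.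
  by rewrite et e12 e23 catA.
have [f2 i23 e23] := (concatP _ _ _).1 c23.
move=> /concatP[f1' it et]; apply/concatP.
by split; rewrite ?f12 ?it ?i12// et e23 e12 catA.
Qed.

Lemma concat_vertex w : concat w (vertex (fin w)) = Some w.
Proof. by apply/concatP; split; rewrite ?cats0. Qed.

Lemma vertex_concat w : concat (vertex (ini w)) w = Some w.
Proof. exact/concatP. Qed.

Definition starts e w := if edges w is f :: _ then f == e else false.

Lemma startsP e w :
  reflect (exists t, concat (edge_path e) t = Some w) (starts e w).
Proof.
apply: (iffP idP) => [|[t /concat_edges]]; last first.
  by rewrite /starts => -> /=.
rewrite /starts; case Ew : (edges w) => [//|f p] /eqP fe.
have := valP w; rewrite /is_path -/(edges w) Ew /= fe => /andP[/eqP sw ap].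
by exists (@Fsgd _ (tgt e, p) ap); apply/concatP; split; rewrite ?Ew ?fe.
Qed.

End Paths.

(** * Generation by the edges *)
Section GraphAlgebra.
Variables (R : realType) (G : digraph).
Local Notation F := (fsgd G).
Local Notation H := (hilbert R F).
Local Notation D := (diag_alg R G).
Local Notation E := (cond_exp R G).
Local Notation L := (@creation R G).
Local Notation M := (graph_walg R G).
Local Notation A := (fun e : edge G => walg_over_diag (set1 (L (edge_path e)))).
Implicit Types (w u : F) (x y : H) (v : vert G) (T S : H -> H).

Lemma creation_mul w w' u : concat w w' = Some u -> L u = L w \o L w'.
Proof.
move=> cu; apply/funext => x; apply: hilbertP => z.
rewrite -[LHS]/(oapp (hval x) 0 (ldiv u z)).
rewrite -[RHS]/(oapp (fun t => oapp (hval x) 0 (ldiv w' t)) 0 (ldiv w z)).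
rewrite oapp_obind; congr oapp; apply: option_ext => t; split.
  move=> /ldivP/(concat_assoc _ _ cu)[s h1 h2]; apply/obindP; exists s; exact/ldivP.
move=> /obindP[s /ldivP h1 /ldivP h2]; apply/ldivP/(concat_assoc _ _ cu).
by exists s.
Qed.

Lemma graph_gens T : [set L w | w in [set: F]] T ->
  bounded_op T /\ exists S, adjoint T S.
Proof.
move=> [w _ <-]; split; first exact: creation_bounded.
by exists (annihilation w); exact: creation_adjoint.
Qed.

Lemma graph_walg_wstar : wstar M = M.
Proof. exact/wstar_idem/graph_gens. Qed.

Lemma diag_sub_graph : D `<=` M.
Proof.
apply/wclosure_mono/alg_mono => _ [v _ <-]; left; by exists (vertex v).
Qed.

Lemma creation_in_graph w : M (L w).
Proof. by apply: sub_wstar; [exact: graph_gens|exists w]. Qed.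

Lemma annihilation_in_graph w : M (annihilation w).
Proof.
apply: wclosure_adjoint (@creation_adjoint R G w).
  exact/starred_adjoints/graph_gens.
exact: creation_in_graph.
Qed.

Lemma diag_adjoint T S : D T -> adjoint T S -> D S.
Proof. exact/wclosure_adjoint/diag_starred. Qed.

(** The adjoint is explicit, since T is diagonal. *)
Lemma diag_has_adjoint T : D T -> exists S, adjoint T S.
Proof.
move=> DT; rewrite -(cond_exp_id DT) cond_exp_mulop.
have [_ [c /vcoef_bound hc]] := diag_bounded DT.
by eexists; apply: (mulop_adjoint (c := c)) => u.
Qed.

Section Generators.
Variable Q : set (H -> H).
Hypothesis QL : forall T, Q T -> exists w, T = L w.

Lemma over_diag_gens T : (Q `|` D) T -> bounded_op T /\ exists S, adjoint T S.
Proof.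
case=> [/QL[w ->]|DT]; first by apply: graph_gens; exists w.
by split; [exact: diag_bounded|exact: diag_has_adjoint].
Qed.

Lemma over_diag_wstar : wstar (walg_over_diag Q) = walg_over_diag Q.
Proof. exact/wstar_idem/over_diag_gens. Qed.

Lemma diag_sub_over_diag : D `<=` walg_over_diag Q.
Proof. by move=> T DT; apply: sub_wstar; [exact: over_diag_gens|right]. Qed.

Lemma sub_over_diag : Q `<=` walg_over_diag Q.
Proof. by move=> T QT; apply: sub_wstar; [exact: over_diag_gens|left]. Qed.

End Generators.

Lemma edge_gen e T : set1 (L (edge_path e)) T -> exists w, T = L w.
Proof. by move=> ->; exists (edge_path e). Qed.

Lemma edge_algebra_sub_graph e : A e `<=` M.
Proof.
apply: wstar_least graph_walg_wstar => T [->|]; first exact: creation_in_graph.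
exact: diag_sub_graph.
Qed.

(** L_w is the product of the L_e over the edges of w.  The comparison goes
    through the generators L_e and D_G, for which adjoints are explicit, rather
    than through the algebras A_e, whose elements are only weak limits. *)
Lemma graph_walg_generated : M = wstar (D `|` \bigcup_e A e).
Proof.
pose Q := [set L (edge_path e) | e in [set: edge G]].
have QL T : Q T -> exists w, T = L w by move=> [e _ <-]; exists (edge_path e).
have gQ := over_diag_gens QL.
apply/seteqP; split; last first.
  apply: wstar_least graph_walg_wstar => T [|[e _]]; first exact: diag_sub_graph.
  exact: edge_algebra_sub_graph.
apply: (@subset_trans _ (wstar (Q `|` D))); last first.
  apply: wstar_mono => T [[e _ <-]|DT]; last by left.
  by right; exists e => //; exact: (sub_over_diag (@edge_gen e)).
apply: (wstar_least _ (wstar_idem gQ)) => _ [w _ <-].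
have sQ := starred_adjoints gQ.
have [n] := ubnP (size (edges w)); elim: n w => // n IH w.
case Ew : (edges w) => [|e p] /= hn.
  have -> : w = vertex (ini w) by exact: fsgd_eq.
  apply: (diag_sub_over_diag QL); apply: (sub_wclosure_alg (@diag_starred R G)).
  by apply: alg_gen; exists (ini w).
have /startsP[t ct] : starts e w by rewrite /starts Ew.
rewrite (creation_mul ct); apply: (wclosure_mul sQ).
  by apply: (sub_over_diag QL); exists e.
apply: IH; have := concat_edges ct; rewrite Ew /= => -[<-].
exact: hn.
Qed.

(** * Freeness of the edge algebras *)
Section EdgeCommutant.
Variables (e : edge G) (u : F).
Hypothesis ue : ~~ starts e u.

Definition edge_power w : bool := all (pred1 e) (edges w).

(** pull append_power is the partial isometry from the span of the e...eu to
    the span of the e...e, where e...e ends at the initial vertex of u. *)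
Definition append_power w : option F :=
  if edge_power w then concat w u else None.

Lemma append_powerP w t :
  (append_power w = Some t) <-> (edge_power w /\ concat w u = Some t).
Proof. by rewrite /append_power; case: (edge_power w); split=> // -[]. Qed.

Lemma append_power_inj w w' t :
  append_power w = Some t -> append_power w' = Some t -> w = w'.
Proof. by move=> /append_powerP[_ h] /append_powerP[_ h']; exact: concat_injl h h'. Qed.

Lemma append_power_vertex : append_power (vertex (ini u)) = Some u.
Proof. by apply/append_powerP; split=> //; exact: vertex_concat. Qed.

Lemma edge_powerS w t : concat (edge_path e) t = Some w -> edge_power w = edge_power t.
Proof. by rewrite /edge_power => /concat_edges -> /=; rewrite eqxx. Qed.

(** Commutation with L_e.  At a vertex w both sides must vanish, which is where
    it matters that u does not start with e. *)
Lemma append_power_ldiv w :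
  obind append_power (ldiv (edge_path e) w) =
  obind (ldiv (edge_path e)) (append_power w).
Proof.
apply: option_ext => t; split=> /obindP[s].
  move=> /ldivP cs /append_powerP[ps ct].
  have [z cz] : exists z, concat (edge_path e) t = Some z.
    apply: concat_exists; rewrite (concat_ini ct).
    by have /concatP[] := cs.
  apply/obindP; exists z; last exact/ldivP.
  apply/append_powerP; split; first by rewrite (edge_powerS cs).
  by apply/(concat_assoc _ _ cs); exists t.
move=> /append_powerP[pw cz] /ldivP ct.
have /startsP[s' cs] : starts e w.
  have := concat_edges cz; rewrite (concat_edges ct) /starts.
  move: pw; rewrite /edge_power; case: (edges w) => [|f p] /=; last by case/andP.
  (* Here w is a vertex, so that e would be the first edge of u. *)
  by move=> _ h; move: ue; rewrite /starts -h eqxx.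
apply/obindP; exists s'; first exact/ldivP.
apply/append_powerP; split; first by rewrite -(edge_powerS cs).
have /(concat_assoc _ _ cs)[t' h1 h2] := cz.
by move/ldivP: h2; move/ldivP: ct => -> [->].
Qed.

(** Commutation with the adjoint of L_e. *)
Lemma append_power_concat w :
  obind append_power (concat (edge_path e) w) =
  obind (concat (edge_path e)) (append_power w).
Proof.
apply: option_ext => t; split=> /obindP[s].
  move=> cs /append_powerP[ps /(concat_assoc _ _ cs)[s' h1 h2]].
  apply/obindP; exists s' => //; apply/append_powerP.
  by rewrite -(edge_powerS cs).
move=> /append_powerP[pw cs] ct.
have [z cz] : exists z, concat (edge_path e) w = Some z.
  apply: concat_exists; rewrite -(concat_ini cs).
  by have /concatP[] := ct.
apply/obindP; exists z => //; apply/append_powerP.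
split; first by rewrite (edge_powerS cz).
by apply/(concat_assoc _ _ cz); exists s.
Qed.

Lemma edge_algebra_commute T x : A e T ->
  T (pull append_power x) = pull append_power (T x).
Proof.
have CE y w := pullE append_power_inj y w.
apply: (commute_wclosure CE) => {}T {}x.
have diag_commute S y : D S -> S (pull append_power y) = pull append_power (S y).
  move=> DS; apply: hilbertP => w; rewrite diagE// !CE.
  case Ew : (append_power w) => [z|] /=; last by rewrite mulr0.
  by have /append_powerP[_ /concat_ini<-] := Ew; rewrite (diagE y z DS).
move=> [[->|DT]|[U [->|DU] UT]].
- apply: (pull_commute CE (h := ldiv (edge_path e))) => //.
  exact: append_power_ldiv.
- exact: diag_commute.
- rewrite (adjoint_unique UT (@creation_adjoint R G _)).
  apply: (pull_commute CE (h := concat (edge_path e))); first exact: annihilationE.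
  exact: append_power_concat.
- by apply: diag_commute; exact: diag_adjoint UT.
Qed.

(** Compare the two sides of the commutation at the initial vertex v of u: the
    partial isometry maps x to x(u) times the basis vector of v. *)
Lemma edge_algebra_off T x : A e T -> (forall w, starts e w -> x w = 0) ->
  T x u = vcoef T (ini u) * x u.
Proof.
move=> AT xe; have CE y w := pullE append_power_inj y w.
have -> : T x u = pull append_power (T x) (vertex (ini u)).
  by rewrite CE append_power_vertex.
rewrite -edge_algebra_commute//.
have -> : pull append_power x = x u *: basis (vertex (ini u)).
  apply: hilbertP => w; rewrite CE coordZ /=.
  case: eqP => [->|wv]; first by rewrite append_power_vertex mulr1.
  rewrite mulr0; case Ew : (append_power w) => [z|] //=; apply: xe.
  have /append_powerP[pw cz] := Ew; rewrite /starts (concat_edges cz).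
  case Ep : (edges w) pw => [|f p]; last by rewrite /edge_power Ep /= => /andP[].
  case: wv; apply: fsgd_eq; rewrite ?Ep//= -[RHS]/(ini u).
  by have /concatP[<- _ _] := cz; rewrite /fin Ep.
rewrite linopZ; last exact/bounded_linear/wclosure_bounded/AT.
by rewrite coordZ -vcoefE mulrC.
Qed.

End EdgeCommutant.

Lemma op_prodS n (a : nat -> H -> H) :
  op_prod n.+1 a = a 0%N \o op_prod n (fun k => a k.+1).
Proof. by rewrite /op_prod big_ord_recl. Qed.

Lemma op_prod0 (a : nat -> H -> H) : op_prod 0 a = a 0%N.
Proof. by rewrite /op_prod big_ord_recl big_ord0. Qed.

Lemma op_prod_bounded n (a : nat -> H -> H) :
  (forall k, (k <= n)%N -> bounded_op (a k)) -> bounded_op (op_prod n a).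
Proof.
elim: n a => [|n IH] a ba; first by rewrite op_prod0; exact: ba.
rewrite op_prodS; apply: bounded_comp; first exact: ba.
by apply: IH => k kn; exact: ba.
Qed.

(** For n = 0 this is edge_algebra_off.  For the induction step, the remaining
    product sends x to a vector that lives on paths starting with j 1; as
    j 1 <> j 0 it vanishes on those starting with j 0, and the first factor can
    be applied. *)
Lemma op_prod_off n (j : nat -> edge G) (a : nat -> H -> H) x :
  (forall k, (k <= n)%N -> A (j k) (a k) /\ E (a k) = (fun=> 0)) ->
  (forall k, (k < n)%N -> j k <> j k.+1) ->
  (forall w, starts (j n) w -> x w = 0) ->
  forall u, ~~ starts (j 0%N) u -> op_prod n a x u = 0.
Proof.
have step e T y u : A e T -> E T = (fun=> 0) ->
    (forall w, starts e w -> y w = 0) -> ~~ starts e u -> T y u = 0.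
  move=> AT ET ye ue; rewrite (edge_algebra_off ue AT ye).
  by rewrite vcoef_cond_exp0 ?mul0r//; exact: wclosure_bounded AT.
elim: n j a => [|n IH] j a Aa jj xj u uj.
  by rewrite op_prod0; have [Aa0 Ea0] := Aa 0%N (leqnn _); exact: step Aa0 Ea0 xj uj.
rewrite op_prodS; have [Aa0 Ea0] := Aa 0%N (leq0n _).
apply: step Aa0 Ea0 _ uj => w wj.
apply: (IH (fun k => j k.+1)) => //.
- by move=> k kn; exact: Aa.
- by move=> k kn; exact: jj.
- have := jj 0%N (ltn0Sn _); move: wj; rewrite /starts.
  by case: (edges w) => // f p /eqP -> /eqP.
Qed.

Lemma edge_algebras_free : free_over E A.
Proof.
move=> n j a Aa jj; apply: cond_exp0 => [|v].
  by apply: op_prod_bounded => k /Aa[AT _]; exact: wclosure_bounded AT.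
rewrite vcoefE; apply: (op_prod_off Aa jj) => // w.
by rewrite /starts /=; case: eqP => // ->.
Qed.

(** * Nondegeneracy *)

(** pull (keep_fin v) is the projection onto the paths that end at v; left
    multiplications leave the final vertex alone. *)
Definition keep_fin v w : option F := if fin w == v then Some w else None.

Lemma keep_finP v w u : (keep_fin v w = Some u) <-> (fin w = v /\ w = u).
Proof.
by rewrite /keep_fin; split; [case: eqP => // ? [<-]|case=> -> ->; rewrite eqxx].
Qed.

Lemma keep_fin_commute v (h : F -> option F) w :
  (forall s t, h s = Some t -> fin t = fin s) ->
  obind (keep_fin v) (h w) = obind h (keep_fin v w).
Proof.
move=> hf; apply: option_ext => t; split=> /obindP[s].
  move=> hs /keep_finP[fs <-]; apply/obindP; exists w => //.
  by apply/keep_finP; rewrite -(hf _ _ hs).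
move=> /keep_finP[fw <-] ht; apply/obindP; exists t => //.
by apply/keep_finP; rewrite (hf _ _ ht).
Qed.

Lemma graph_fin T u w : M T -> fin w != fin u -> T (basis u) w = 0.
Proof.
move=> MT wu; pose g := keep_fin (fin w).
have g_inj s s' t : g s = Some t -> g s' = Some t -> s = s'.
  by move=> /keep_finP[_ ->] /keep_finP[_ ->].
have CE y t := pullE g_inj y t.
have C0 : pull g (basis u) = 0 :> H.
  apply: hilbertP => t; rewrite CE; case Et : (g t) => [z|] //=.
  have /keep_finP[ft tz] := Et; case: eqP => // zu.
  by move: wu; rewrite -ft tz zu eqxx.
have -> : T (basis u) w = pull g (T (basis u)) w by rewrite CE /g /keep_fin eqxx.
rewrite -(commute_wclosure CE _ _ MT) ?C0 ?linop0//.
  exact/bounded_linear/wclosure_bounded/MT.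
move=> S y [[z _ <-]|[_ [z _ <-] zS]].
  apply: (pull_commute CE (h := ldiv z)) => // t; apply: keep_fin_commute.
  by move=> s s' /ldivP/concat_fin.
rewrite (adjoint_unique zS (@creation_adjoint R G _)).
apply: (pull_commute CE (h := concat z)) => [|t]; first exact: annihilationE.
by apply: keep_fin_commute => s s'; exact: concat_fin.
Qed.

(** E(L_w^* T L_u) has the coefficient <T xi_u, xi_w> at the common final vertex
    of u and w. *)
Lemma graph_nondegenerate T : M T ->
  (forall S U, M S -> M U -> E (S \o T \o U) = (fun=> 0)) -> T = (fun=> 0).
Proof.
move=> MT hT; have bT := wclosure_bounded MT.
apply: bounded_eq0 => // u; apply: hilbertP => w.
have [fwu|] := eqVneq (fin w) (fin u); last exact: graph_fin.
have h := hT _ _ (annihilation_in_graph w) (creation_in_graph u).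
have /vcoef_cond_exp0-/(_ (fin u) h) :
    bounded_op (annihilation w \o T \o L u).
  apply: bounded_comp; last exact: creation_bounded.
  by apply: bounded_comp => //; exact: wclosure_bounded (annihilation_in_graph w).
rewrite vcoefE [X in hval X](_ : _ = annihilation w (T (L u (basis (vertex (fin u))))))//.
by rewrite creation_basis concat_vertex annihilationE -fwu concat_vertex.
Qed.

(** A centred element of D_G is 0, and alternation puts one among the first two
    factors unless the product is a single centred element of W*(G). *)
Lemma diag_free : free_over E (fun b : bool => if b then D else M).
Proof.
move=> n j a Aa jj.
have ba k : (k <= n)%N -> bounded_op (a k).
  by move=> /Aa[+ _]; case: (j k) => /wclosure_bounded.
have a0 k : (k <= n)%N -> j k = true -> a k = (fun=> 0).
  by move=> /Aa[+ Ea] jk; rewrite jk => /cond_exp_id <-.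
case: n => [|n] in Aa jj ba a0 *; first by rewrite op_prod0; case: (Aa 0%N).
have bp := op_prod_bounded ba.
suff p0 : op_prod n.+1 a = (fun=> 0).
  by apply: cond_exp0 => // v; rewrite p0 vcoefE.
rewrite op_prodS; case j0 : (j 0%N).
  by rewrite (a0 0%N).
have j1 : j 1%N = true by have := jj 0%N isT; rewrite j0; case: (j 1%N).
have l0 : a 0%N 0 = 0 by apply: linop0; exact: bounded_linear (ba 0%N _).
apply/funext => x; case: n => [|n] in Aa jj ba a0 bp *.
  by rewrite op_prod0 (a0 1%N).
by rewrite op_prodS (a0 1%N).
Qed.

(** * The free product decomposition *)
Lemma wfree_edges : is_wfree_product D E A M.
Proof.
split.
- move=> e; apply: wprob_space_cond_exp; first exact: over_diag_wstar (@edge_gen e).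
  exact: diag_sub_over_diag (@edge_gen e).
- exact: wprob_space_cond_exp graph_walg_wstar diag_sub_graph.
- exact: graph_walg_generated.
- exact: edge_algebras_free.
- exact: graph_nondegenerate.
Qed.

Lemma wfree_diag : is_wfree_product D E (fun b : bool => if b then D else M) M.
Proof.
have wM := wprob_space_cond_exp graph_walg_wstar diag_sub_graph.
split=> //.
- by case=> //; exact: wprob_space_cond_exp (@diag_wstar R G) _.
- apply/seteqP; split.
    rewrite -{1}graph_walg_wstar; apply: wstar_mono => T MT.
    by right; exists false.
  apply: wstar_least graph_walg_wstar => T [|[[] _//]]; exact: diag_sub_graph.
- exact: diag_free.
- exact: graph_nondegenerate.
Qed.

End GraphAlgebra.

Theorem corollary4p2 (R : realType) (G : digraph) :
  exists B : set (hilbert R (fsgd G) -> hilbert R (fsgd G)),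
    is_wfree_product (diag_alg R G) (cond_exp R G)
      (fun e : edge G => walg_over_diag (set1 (creation (edge_path e)))) B /\
    is_wfree_product (diag_alg R G) (cond_exp R G)
      (fun b : bool => if b then diag_alg R G else B) (graph_walg R G).
Proof. by exists (graph_walg R G); split; [exact: wfree_edges|exact: wfree_diag]. Qed.
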